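(* Let $A,B,D$ be real $d\times d$ matrices such that $A^{-1}D$ is a symmetric rational matrix and $A^tB=I$, and let $$\Lambda=\begin{pmatrix} A & D\\ O & B\end{pmatrix}(\mathbb{Z}^{2d}),\qquad \mathrm{dens}(\Lambda)=1.$$ Then there is a set $K\subset\mathbb{R}^d$ (measurable, with positive and finite measure) such that $\mathcal{G}(|K|^{-1/2}\chi_K,\Lambda)$ is a Gabor orthonormal basis for $L^2(\mathbb{R}^d)$.
   Context: For $\Lambda=M(\mathbb{Z}^{2d})$ with $M$ invertible, $\mathrm{dens}(\Lambda)=|\det M|^{-1}$. $|K|$ denotes Lebesgue measure, $\chi_K$ the indicator function of $K$, $A^t$ the transpose of $A$, $I$ the $d\times d$ identity matrix. For $g\in L^2(\mathbb{R}^d)$ and a countable set $\Lambda\subset\mathbb{R}^{2d}$, the Gabor system $\mathcal{G}(g,\Lambda)$ is the collection of functions $\pi(a,b)g(x)=e^{2\pi i\langle b,x\rangle}g(x-a)$, $(a,b)\in\Lambda$ (with $a,b\in\mathbb{R}^d$); it is a Gabor orthonormal basis if it is an orthonormal basis of $L^2(\mathbb{R}^d)$. *)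

(* Defs.v *)
From HB Require Import structures.
From mathcomp Require Import all_boot all_order all_algebra.
From mathcomp Require Import all_classical all_reals all_analysis.
From mathcomp Require Import complex.

Set Implicit Arguments.
Unset Strict Implicit.
Unset Printing Implicit Defensive.

Import Order.TTheory GRing.Theory Num.Theory.
Import numFieldNormedType.Exports.

Local Open Scope classical_set_scope.
Local Open Scope ring_scope.
Local Open Scope complex_scope.

(* The sigma-algebra on 'cV[T]_n is the product one; for T = R it consists of
   the Borel sets of R^n, on which lebesgue_cV below is Lebesgue measure. *)

Definition measure_cV_display : measure_display -> measure_display.
Proof. exact. Qed.

Section measurable_cV.
Context {d} {T : measurableType d}.
Variable n : nat.

Let coor (i : 'I_n) (v : 'cV[T]_n) : T := v i ord0.

Let cV_set0 : g_sigma_preimage coor set0.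
Proof. exact: sigma_algebra0. Qed.

Let cV_setC A : g_sigma_preimage coor A -> g_sigma_preimage coor (~` A).
Proof. exact: sigma_algebraC. Qed.

Let cV_bigcup (F : _^nat) : (forall i, g_sigma_preimage coor (F i)) ->
  g_sigma_preimage coor (\bigcup_i (F i)).
Proof. exact: sigma_algebra_bigcup. Qed.

HB.instance Definition _ := @isMeasurable.Build (measure_cV_display d)
  'cV[T]_n (g_sigma_preimage coor) cV_set0 cV_setC cV_bigcup.

Lemma measurable_coor (i : 'I_n) :
  measurable_fun [set: 'cV[T]_n] (fun v : 'cV[T]_n => v i ord0).
Proof.
move=> _ Y mY; rewrite setTI; apply: sub_sigma_algebra => /=.
rewrite -bigcup_seq/=; exists i => /=; first by rewrite mem_index_enum.
by exists Y => //; rewrite setTI.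
Qed.

Lemma measurable_fun_coorP d1 (T1 : measurableType d1) (f : T1 -> 'cV[T]_n) :
  measurable_fun [set: T1] f <->
  forall i, measurable_fun [set: T1] (fun x => f x i ord0).
Proof.
split=> [mf i|mf].
  exact: (measurableT_comp (measurable_coor i) mf).
move=> _ Y mY; rewrite setTI.
have : (g_sigma_preimage coor) `<=` [set B | measurable (f @^-1` B)].
  apply: smallest_sub.
    split => /=.
    - by rewrite preimage_set0.
    - by move=> A mA; rewrite setTD preimage_setC; exact: measurableC.
    - by move=> F mF; rewrite preimage_bigcup; exact: bigcupT_measurable.
  move=> B; rewrite -bigcup_seq => -[i _ [A mA <-]] /=.
  by rewrite setTI -[X in measurable X]setTI; exact: mf.
exact.
Qed.

Lemma measurable_box (A : 'I_n -> set T) : (forall i, measurable (A i)) ->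
  measurable [set v : 'cV[T]_n | forall i, A i (v i ord0)].
Proof.
move=> mA.
have -> : [set v : 'cV[T]_n | forall i, A i (v i ord0)] =
    \bigcap_(i in [set: 'I_n]) ((fun v : 'cV[T]_n => v i ord0) @^-1` A i).
  by apply/seteqP; split=> v /= H i => [_|]; exact: H.
apply: fin_bigcap_measurable => // i _.
by rewrite -[X in measurable X]setTI; exact: measurable_coor.
Qed.

End measurable_cV.

Definition cV_cons (T : Type) n (p : T * 'cV[T]_n) : 'cV[T]_n.+1 :=
  col_mx (const_mx p.1) p.2 : 'cV[T]_(1 + n).

Definition cV_uncons (T : Type) n (v : 'cV[T]_n.+1) : T * 'cV[T]_n :=
  (v ord0 ord0, dsubmx (v : 'cV[T]_(1 + n))).

Lemma cV_cons0 (T : Type) n (p : T * 'cV[T]_n) : cV_cons p ord0 ord0 = p.1.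
Proof.
rewrite (_ : ord0 = lshift n ord0 :> 'I_(1 + n)); last exact: val_inj.
by rewrite [LHS]col_mxEu mxE.
Qed.

Lemma cV_consS (T : Type) n (p : T * 'cV[T]_n) i :
  cV_cons p (lift ord0 i) ord0 = p.2 i ord0.
Proof.
rewrite (_ : lift ord0 i = rshift 1 i :> 'I_(1 + n)); last exact: val_inj.
by rewrite [LHS]col_mxEd.
Qed.

Lemma cV_consK (T : Type) n : cancel (@cV_cons T n) (@cV_uncons T n).
Proof.
by case=> x v; rewrite /cV_uncons cV_cons0 /cV_cons col_mxKd.
Qed.

Lemma measurable_cV_cons d (T : measurableType d) n :
  measurable_fun setT (@cV_cons T n).
Proof.
apply/measurable_fun_coorP => i; case: (unliftP ord0 i) => [j|] ->.
  under eq_fun do rewrite cV_consS.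
  by apply: (measurableT_comp (measurable_coor j)).
under eq_fun do rewrite cV_cons0.
exact: measurable_fst.
Qed.

Lemma measurable_cV_uncons d (T : measurableType d) n :
  measurable_fun setT (@cV_uncons T n).
Proof.
apply/measurable_fun_pairP; split; first exact: measurable_coor.
apply/measurable_fun_coorP => i.
rewrite (_ : (fun x => _) = fun x : 'cV[T]_n.+1 => x (rshift 1 i) ord0).
  exact: measurable_coor.
by apply/funext => v; rewrite /= mxE.
Qed.

Section prod_cV.
Context {R : realType} (n : nat).
Variable m : {sigma_finite_measure set 'cV[R]_n -> \bar R}.
Local Open Scope ereal_scope.

Definition prod_cV : set 'cV[R]_n.+1 -> \bar R :=
  pushforward (lebesgue_measure \x m) (@cV_cons R n).

Let mcons (A : set 'cV[R]_n.+1) :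
  measurable A -> measurable (@cV_cons R n @^-1` A).
Proof.
by move=> mA; rewrite -[X in measurable X]setTI; exact: measurable_cV_cons.
Qed.

Let prod_cV0 : prod_cV set0 = 0.
Proof. by rewrite /prod_cV /pushforward preimage_set0 measure0. Qed.

Let prod_cV_ge0 A : 0 <= prod_cV A.
Proof. exact: (measure_ge0 (lebesgue_measure \x m)). Qed.

Let prod_cV_sigma_additive : semi_sigma_additive prod_cV.
Proof.
move=> F mF tF mUF; rewrite /prod_cV /pushforward preimage_bigcup.
apply: measure_semi_sigma_additive.
- by move=> k; exact: mcons.
- apply/trivIsetP => /= i j _ _ ij; rewrite -preimage_setI.
  by move/trivIsetP : tF => /(_ _ _ _ _ ij) ->//; rewrite preimage_set0.
- by rewrite -preimage_bigcup; exact: mcons.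
Qed.

HB.instance Definition _ := isMeasure.Build _ _ _ prod_cV
  prod_cV0 prod_cV_ge0 prod_cV_sigma_additive.

Let prod_cV_sigma_finite : sigma_finite setT prod_cV.
Proof.
have /sigma_finiteP[F [TF ndF Foo]] := sigma_finiteT (@lebesgue_measure R).
have /sigma_finiteP[G [TG ndG Goo]] := sigma_finiteT m.
exists (fun k => @cV_uncons R n @^-1` (F k `*` G k)).
  rewrite -preimage_bigcup (_ : \bigcup_i _ = setT) ?preimage_setT//.
  rewrite -setXTT TF TG predeqE => -[x y]; split.
    by move=> [k _ []/= ? ?]; split; exists k.
  move=> [/= [k _ Fkx] [l _ Gly]]; exists (maxn k l) => //; split.
  - by move: x Fkx; exact/subsetPset/ndF/leq_maxl.
  - by move: y Gly; exact/subsetPset/ndG/leq_maxr.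
move=> k; have [mF Fk] := Foo k; have [mG Gk] := Goo k; split.
  rewrite -[X in measurable X]setTI; apply: measurable_cV_uncons => //.
  exact: measurableX.
rewrite /prod_cV /pushforward -comp_preimage.
rewrite (_ : _ \o _ = id) ?preimage_id; last exact/funext/cV_consK.
by rewrite product_measure1E// lte_mul_pinfty// ge0_fin_numE.
Qed.

HB.instance Definition _ := Measure_isSigmaFinite.Build _ _ _ prod_cV
  prod_cV_sigma_finite.

End prod_cV.

(* The n-fold product of the one-dimensional Lebesgue measure. *)
Fixpoint lebesgue_cV (R : realType) (n : nat) :
    {sigma_finite_measure set 'cV[R]_n -> \bar R} :=
  if n is n'.+1 return {sigma_finite_measure set 'cV[R]_n -> \bar R}
  then prod_cV (lebesgue_cV R n') else \d_(0 : 'cV[R]_0).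

Lemma lebesgue_cV_box (R : realType) n (A : 'I_n -> set R) :
  (forall i, measurable (A i)) ->
  lebesgue_cV R n [set v | forall i, A i (v i ord0)] =
  (\prod_(i < n) lebesgue_measure (A i))%E.
Proof.
elim: n A => [|n IHn] A mA.
  by rewrite big_ord0 /= diracE mem_set//= => -[].
rewrite big_ord_recl -IHn//= -product_measure1E//; first last.
  by apply: (measurable_box (A := fun i => A (lift ord0 i))) => i; exact: mA.
  exact: mA.
rewrite /prod_cV /pushforward; congr (product_measure1 _ _ _).
apply/seteqP; split => [[x v] /= H|[x v] /= [H0 H] i].
  by split=> [|i]; [have := H ord0; rewrite cV_cons0
                   |have := H (lift ord0 i); rewrite cV_consS].
by case: (unliftP ord0 i) => [j|] ->; rewrite ?cV_consS ?cV_cons0.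
Qed.

Section L2.
Context {R : realType} {d : nat}.
Implicit Types f g : 'cV[R]_d -> R[i].

Definition measurable_complex f :=
  measurable_fun setT (fun x => complex.Re (f x)) /\
  measurable_fun setT (fun x => complex.Im (f x)).

Definition L2norm f : \bar R :=
  'N[lebesgue_cV R d]_2%:E[EFin \o (@Normc.normc R \o f)]%E.

Definition L2 f := measurable_complex f /\ (L2norm f < +oo)%E.

Definition complex_integral f : R[i] :=
  (\int[lebesgue_cV R d]_x complex.Re (f x))%R +i*
  (\int[lebesgue_cV R d]_x complex.Im (f x))%R.

Definition L2inner f g : R[i] := complex_integral (fun x => f x * (g x)^*).

(* Orthonormality is that of the indexed family (so distinct indices give
   orthogonal functions); completeness is density of the linear span in L^2.
   Functions stand for their classes modulo almost everywhere equality. *)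
Definition orthonormal_basis (I : eqType) (S : set I)
    (e : I -> 'cV[R]_d -> R[i]) :=
  [/\ forall i, S i -> L2 (e i),
      forall i j, S i -> S j -> L2inner (e i) (e j) = (i == j)%:R
    & forall f, L2 f -> forall eps : R, 0 < eps ->
      exists (s : seq I) (c : I -> R[i]), (forall i, i \in s -> S i) /\
        (L2norm (fun x => f x - \sum_(i <- s) c i * e i x)%R < eps%:E)%E].

End L2.

Section Gabor.
Context {R : realType}.

Definition lattice n (M : 'M[R]_n) : set 'cV[R]_n :=
  [set M *m map_mx intr k | k in [set: 'cV[int]_n]].

Definition lattice_density n (M : 'M[R]_n) : R := `|\det M|^-1.

Definition expi (t : R) : R[i] := cos t +i* sin t.

Definition dotprod d (x y : 'cV[R]_d) : R := \sum_(i < d) x i ord0 * y i ord0.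

(* z = (a, b) with a = usubmx z and b = dsubmx z. *)
Definition tf_shift d (z : 'cV[R]_(d + d)) (g : 'cV[R]_d -> R[i]) :
    'cV[R]_d -> R[i] :=
  fun x => expi (2 * pi * dotprod (dsubmx z) x) * g (x - usubmx z).

Definition gabor_orthonormal_basis d (g : 'cV[R]_d -> R[i])
    (Lambda : set 'cV[R]_(d + d)) :=
  orthonormal_basis Lambda (fun z => tf_shift z g).

Definition normalized_indicator d (K : set 'cV[R]_d) : 'cV[R]_d -> R[i] :=
  fun x => ((Num.sqrt (fine (lebesgue_cV R d K)))^-1 * \1_K x)%:C.

Definition rational_mx m n (M : 'M[R]_(m, n)) :=
  exists Q : 'M[rat]_(m, n), M = map_mx ratr Q.

End Gabor.

(* Main.v *)
(* Put S = A^-1 D.  Since S is rational, Z^d + S Z^d = C Z^d for some invertible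
   C, and since S is symmetric, {l in Z^d | S l in Z^d} is the dual lattice
   C^-T Z^d.  With P = A C this turns Lambda into the set of the points
   (P k, F k + P^-T l), for some matrix F and k, l in Z^d.  Take K = P [0, 1)^d:
   for fixed k the system consists of the characters of R^d / P Z^d on the tile
   K + P k, all multiplied by one unimodular function, and the tiles partition
   R^d.  Orthogonality of the characters follows from translation invariance of
   Lebesgue measure alone, so its scaling under P is not needed.  Completeness
   follows from a monotone class argument on each tile. *)
Require Import Defs.
From HB Require Import structures.
From mathcomp Require Import all_boot all_order all_algebra.
From mathcomp Require Import all_classical all_reals all_analysis.
From mathcomp Require Import complex measurable_realfun.
From mathcomp Require Import ring lra.

Set Implicit Arguments.
Unset Strict Implicit.
Unset Printing Implicit Defensive.

Import Order.TTheory GRing.Theory Num.Theory.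
Import numFieldNormedType.Exports.

Local Open Scope classical_set_scope.
Local Open Scope ring_scope.

(** A character with a nonzero i-th frequency changes sign under a translation by half a period in
    the i-th coordinate of P. The tile is not invariant under that translation, but what leaves it
    re-enters through the opposite face after a further translation by -1, which the character does
    not see; so its integral is its own negative. The measure of the tile enters only through the
    normalisation, where it must be positive and finite.

    For completeness, the obstacle is to reach indicator functions from trigonometric polynomials.
    Iterates of an odd cubic fixing -1, 0 and 1 are polynomials converging to the sign function on
    [-1, 1]. Hence an algebra closed under bounded pointwise limits contains the indicator of {v >
    0} for each of its elements v with |v| <= 1. A trigonometric polynomial of degree one suffices
    to cut a tile along a hyperplane where one coordinate is constant, and such half-spaces generate
    the Borel sets. Bounded limits become L2 limits only afterwards, by dominated convergence on a
    tile of finite measure. *)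

Definition int_cV (R : realType) n (k : 'cV[int]_n) : 'cV[R]_n := map_mx intr k.

(** * Lattices *)

Section lattice_algebra.
Variable R : realType.

Lemma rational_mx_denom m n (S : 'M[R]_(m, n)) : rational_mx S ->
  exists (q : nat) (N : 'M[int]_(m, n)), (0 < q)%N /\ q%:R *: S = map_mx intr N.
Proof.
case=> Q ->.
pose q : nat := (\prod_(i < m) \prod_(j < n) `|denq (Q i j)|)%N.
have q0 : (0 < q)%N.
  by rewrite prodn_gt0// => i; rewrite prodn_gt0// => j; rewrite absz_gt0 denq_eq0.
have dvdq i j : exists c : nat, q = (c * `|denq (Q i j)|)%N.
  by apply/dvdnP; rewrite /q (bigD1 i)//= (bigD1 j)//= -mulnA dvdn_mulr.
have zq i j : exists z : int, q%:R * Q i j = z%:~R.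
  have [c ->] := dvdq i j; exists (c%:Z * numq (Q i j)).
  rewrite -{2}(divq_num_den (Q i j)) natrM intrM -mulrA; congr (_ * _).
  rewrite [(_ / _)]mulrC mulrA natr_absz ger0_norm ?denq_ge0//.
  by rewrite mulfV ?mul1r// intr_eq0 denq_eq0.
exists q, (\matrix_(i, j) projT1 (cid (zq i j))); split=> //.
apply/matrixP => i j; rewrite !mxE; case: cid => z /= zE.
by rewrite -[z%:~R](ratr_int R) -zE rmorphM /= ratr_nat.
Qed.

(* The lattice Z^d + S Z^d is C Z^d, all the inclusions being witnessed by
   integer matrices. *)
Lemma lattice_sum_basis d (S : 'M[R]_d) : rational_mx S ->
  exists (C : 'M[R]_d) (X Y U V : 'M[int]_d),
    [/\ C *m map_mx intr X = 1%:M, C *m map_mx intr Y = S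
      & C = map_mx intr U + S *m map_mx intr V].
Proof.
move=> /rational_mx_denom[q [N [q0 qS]]].
have qR0 : q%:R != 0 :> R by rewrite pnatr_eq0 -lt0n.
(* The columns of (q I | N) generate q (Z^d + S Z^d). In the Smith form L (D' 0) T the factors L and
   T are unimodular, so that this lattice is L D' Z^d; dividing by q gives [C]. *)
pose N' : 'M[int]_(d, d + d) := row_mx (q%:R%:M) N.
have [L uL [T uT [s _ N'E]]] := int_Smith_normal_form N'.
pose D' : 'M[int]_d := \matrix_(i, j) (s`_i *+ (i == j :> nat)).
pose J : 'M[int]_(d, d + d) := row_mx 1%:M 0.
have DE : \matrix_(i, j) (s`_i *+ (i == j :> nat)) = D' *m J :> 'M[int]_(d, d + d).
  rewrite /J mul_mx_row mulmx1 mulmx0; apply/matrixP => i j; rewrite !mxE.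
  case: splitP => k jk; rewrite !mxE jk //.
  by rewrite (ltn_eqF (ltn_addr _ (ltn_ord i))) mulr0n.
(* [W] is made of the first d columns of T^-1; its two halves express the columns of [C] in terms of
   Z^d and S Z^d. Conversely the first d rows of T, [J *m T], express the columns of 1 and S in
   terms of those of [C]. *)
pose W := invmx T *m col_mx 1%:M 0.
have N'R : row_mx (q%:R%:M) (q%:R *: S) = map_mx intr N' :> 'M[R]_(d, d + d).
  by rewrite /N' map_row_mx map_scalar_mx qS rmorph_nat.
have NW : N' *m W = L *m D'.
  rewrite /W N'E DE !mulmxA (mulmxK uT) -!mulmxA.
  by rewrite /J mul_row_col mulmx1 mulmx0 addr0 mulmx1.
pose C : 'M[R]_d := q%:R^-1 *: map_mx intr (L *m D').
have CJT : C *m map_mx intr (J *m T) = row_mx 1%:M S.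
  rewrite /C -scalemxAl -map_mxM mulmxA -[_ *m D' *m J]mulmxA -DE -N'E -N'R.
  by rewrite scale_row_mx -mul_scalar_mx -scalar_mxM mulVf// scalerK.
exists C, (lsubmx (J *m T)), (rsubmx (J *m T)), (usubmx W), (dsubmx W).
rewrite -[J *m T]hsubmxK in CJT; move: CJT.
rewrite map_row_mx mul_mx_row => /eq_row_mx[-> ->]; split=> //.
rewrite /C -NW -[in LHS](vsubmxK W) map_mxM -N'R map_col_mx mul_row_col.
rewrite mul_scalar_mx scalerDr -scalemxAl !scalerA mulVf// !scale1r.
by [].
Qed.

(* In the new coordinates the fibre of the lattice over each point of P Z^d is
   a coset of the dual lattice of P Z^d; this is where symmetry is used. *)
Lemma lattice_fibration d (A B D : 'M[R]_d) :
  (invmx A *m D)^T = invmx A *m D -> rational_mx (invmx A *m D) ->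
  A^T *m B = 1%:M ->
  exists P F : 'M[R]_d, P \in unitmx /\
    lattice (block_mx A D 0 B) =
    [set col_mx (P *m int_cV R kj.1)
       (F *m int_cV R kj.1 + (invmx P)^T *m int_cV R kj.2) | kj in setT].
Proof.
set S := invmx A *m D => symS /lattice_sum_basis[C [X [Y [U [V [CX CY CE]]]]]] AB.
have uA : A \in unitmx by rewrite -unitmx_tr; case/mulmx1_unit: AB.
have [uC _] := mulmx1_unit CX.
have DE : D = A *m S by rewrite mulKVmx.
clearbody S.
have BE : B = (invmx A)^T by rewrite trmx_inv -[RHS]mulmx1 -AB mulKmx ?unitmx_tr.
have uAC : A *m C \in unitmx by rewrite unitmx_mul uA.
have XE : map_mx intr X = invmx C by rewrite -[RHS]mulmx1 -CX mulKmx.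
have YE : map_mx intr Y = invmx C *m S by rewrite -CY mulKmx.
have PT : (invmx (A *m C))^T = B *m map_mx intr X^T.
  rewrite BE -map_trmx XE -trmx_mul; congr (_^T).
  by rewrite -[RHS]mul1mx -(mulVmx uAC) !mulmxA mulmxK// mulmxK.
(* X^T is C^-T, so this says that S maps the dual lattice into Z^d. It is the transpose of Y = C^-1
   S, by symmetry of S. *)
have SX : S *m map_mx intr X^T = map_mx intr Y^T.
  by rewrite -!map_trmx XE YE trmx_mul symS.
have CT : C^T = (map_mx intr U)^T + (map_mx intr V)^T *m S.
  by rewrite CE [LHS]linearD /= trmx_mul symS.
exists (A *m C), (B *m map_mx intr V); split=> //.
rewrite PT; apply/seteqP; split=> [z [k _ <-]|z [[m j] _ <-]] /=.
  rewrite -[k]vsubmxK map_col_mx mul_block_col mul0mx add0r.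
  move: (usubmx k) (dsubmx k) => {}k l.
  (* The first component is m = C^-1 (k + S l). The second must solve B l = B V m + B X^T j, that is
     j = C^T (l - V m). It is an integer vector because C^T = U^T + V^T S and S (l - V m) = C m - k
     - S V m = U m - k. *)
  exists (X *m k + Y *m l,
    U^T *m (l - V *m (X *m k + Y *m l)) + V^T *m (U *m (X *m k + Y *m l) - k)) => //=.
  set m := X *m k + Y *m l.
  have Cm : C *m map_mx intr m = map_mx intr k + S *m map_mx intr l.
    by rewrite /m map_mxD !map_mxM mulmxDr !mulmxA CX CY mul1mx.
  congr col_mx.
    by rewrite -mulmxA Cm mulmxDr DE mulmxA.
  rewrite /int_cV -!mulmxA -mulmxDr; congr (_ *m _).
  have -> : map_mx intr (U^T *m (l - V *m m) + V^T *m (U *m m - k)) =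
      C^T *m map_mx intr (l - V *m m) :> 'cV[R]_d.
    rewrite CT map_mxD !map_mxM -!map_trmx mulmxDl.
    congr (_ + _); rewrite -mulmxA; congr (_ *m _).
    rewrite !map_mxB mulmxBr !map_mxM -[S *m map_mx intr l](addKr (map_mx intr k)) -Cm.
    by rewrite CE mulmxDl -!mulmxA -addrA addrK addrC.
  rewrite -map_trmx mulmxA -trmx_mul CX trmx1 mul1mx.
  by rewrite map_mxB map_mxM addrC subrK.
(* The term X^T j adds B X^T j to the second component and S X^T j = Y^T j to the first, before
   multiplication by A; subtracting Y^T j compensates for the latter. *)
exists (col_mx (U *m m - Y^T *m j) (V *m m + X^T *m j)) => //.
rewrite map_col_mx mul_block_col mul0mx add0r; congr col_mx.
  rewrite DE -!mulmxA -mulmxDr; congr (_ *m _).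
  rewrite map_mxB map_mxD mulmxDr !map_mxM !mulmxA SX CE mulmxDl /int_cV.
  by rewrite addrA addrAC subrK.
by rewrite /int_cV map_mxD !map_mxM mulmxDr !mulmxA.
Qed.

End lattice_algebra.

(** * Translation invariance and fundamental domains *)

(* The measure structure of a pushforward depends on a proof of measurability,
   which canonical structure inference cannot supply. *)
Local Notation pushforward_measure :=
  measure_function_pushforward__canonical__measure_function_Measure.

Section translation_invariance.
Context {R : realType}.

Lemma lebesgue_measure_shift (t : R) (A : set (measurableTypeR R)) :
  measurable A ->
  lebesgue_measure
    ((fun x : measurableTypeR R => x + t : measurableTypeR R) @^-1` A) =
  lebesgue_measure A.
Proof.
move=> mA.
have mt : measurable_fun setT (fun x : measurableTypeR R => x + t : measurableTypeR R).
  by apply: measurable_funD.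
pose m := pushforward_measure (@lebesgue_measure R) mt.
apply/esym; rewrite (@lebesgue_measure_unique _ m) // => X /ocitvP[->|[[a b]/= ab ->]].
  by rewrite !measure0.
rewrite /m /= /pushforward.
have -> : (fun x : measurableTypeR R => x + t) @^-1` `]a, b] = `]a - t, b - t]%classic.
  by apply/seteqP; split=> x /=; rewrite !in_itv /= ltrBlDr lerBrDr.
rewrite !lebesgue_measure_itv /= !lte_fin ltrD2r; case: ifPn => // _.
by rewrite -EFinD -EFinB; congr (_%:E); lra.
Qed.

Lemma measurable_cV_shift d (t : 'cV[R]_d) :
  measurable_fun setT (fun v : 'cV[R]_d => v + t).
Proof.
apply/measurable_fun_coorP => i.
under eq_fun do rewrite mxE.
by apply: measurable_funD => //; exact: measurable_coor.
Qed.

(** By induction on the dimension: a shift of a column is a shift of its head times a shift of its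
    tail, and a measure agreeing with the product measure on rectangles is equal to it. *)
Lemma lebesgue_cV_shift d (t : 'cV[R]_d) (A : set 'cV[R]_d) : measurable A ->
  lebesgue_cV R d ((fun v => v + t) @^-1` A) = lebesgue_cV R d A.
Proof.
elim: d t A => [|d IH] t A mA.
  congr (lebesgue_cV R 0 _); rewrite (_ : (fun v => v + t) = id) ?preimage_id//.
  by apply/funext => v; rewrite [LHS]flatmx0 [RHS]flatmx0.
rewrite /= /prod_cV /pushforward.
pose t0 := t ord0 ord0; pose t' : 'cV[R]_d := \col_i t (lift ord0 i) ord0.
pose f (p : measurableTypeR R * 'cV[R]_d) : measurableTypeR R * 'cV[R]_d :=
  (p.1 + t0, p.2 + t').
have mf : measurable_fun setT f.
  apply/measurable_fun_pairP; split.
    by apply: measurable_funD => //; exact: measurable_fst.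
  by apply: measurableT_comp (measurable_cV_shift t') (measurable_snd).
have consD p : cV_cons p + t = cV_cons (f p).
  apply/matrixP => i j; rewrite (ord1 j) mxE; case: (unliftP ord0 i) => [k|] ->.
    by rewrite !cV_consS /= !mxE.
  by rewrite !cV_cons0.
have -> : @cV_cons R d @^-1` ((fun v => v + t) @^-1` A) =
    f @^-1` (@cV_cons R d @^-1` A).
  by apply/funext => p; rewrite /preimage /= consD.
have mA' : measurable (@cV_cons R d @^-1` A).
  by rewrite -[X in measurable X]setTI; exact: measurable_cV_cons.
move: (_ @^-1` A) mA' => {A mA}B mB.
pose m := pushforward_measure (lebesgue_measure \x lebesgue_cV R d)%E mf.
transitivity (m B) => //; apply/esym/product_measure_unique => // X Y mX mY.
rewrite /m /= /pushforward.
rewrite (_ : f @^-1` _ = ((fun x => x + t0) @^-1` X) `*`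
  ((fun v => v + t') @^-1` Y)); last by [].
rewrite product_measure1E/=; first by rewrite lebesgue_measure_shift// IH.
- by rewrite -[X in measurable X]setTI; apply: measurable_funD.
- by rewrite -[X in measurable X]setTI; apply: measurable_cV_shift.
Qed.

Lemma integral_cV_shift d (t : 'cV[R]_d) (D : set 'cV[R]_d) (f : 'cV[R]_d -> \bar R) :
  measurable D -> measurable_fun setT f -> (lebesgue_cV R d).-integrable D f ->
  (\int[lebesgue_cV R d]_(x in (fun v => (v + t)%R) @^-1` D) f (x + t)%R
   = \int[lebesgue_cV R d]_(x in D) f x)%E.
Proof.
move=> mD mf /integrableP[_ fi].
have ms := measurable_cV_shift t.
have mD' : measurable ((fun v => v + t) @^-1` D).
  by rewrite -[X in measurable X]setTI; apply: measurable_cV_shift.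
have pE : forall A, measurable A -> A `<=` D ->
    pushforward_measure (lebesgue_cV R d) ms A = lebesgue_cV R d A.
  by move=> A mA _; rewrite /= /pushforward lebesgue_cV_shift.
rewrite -(eq_measure_integral _ pE) integral_pushforward //.
apply/integrableP; split; first by apply: measurable_funTS; exact: measurableT_comp.
rewrite -(ge0_integral_pushforward ms _ mD (f := abse \o f)) //.
- by rewrite (eq_measure_integral _ pE).
- by apply: measurableT_comp => //; exact: measurable_funTS.
- by move=> x _; exact: abse_ge0.
Qed.

End translation_invariance.

(** * The tiling of R^d by the translates of P [0, 1)^d *)

Section lattice_cells.
Context {R : realType}.

Lemma measurable_mulmx m n (M : 'M[R]_(m, n)) :
  measurable_fun setT (fun x : 'cV[R]_n => M *m x).
Proof.
apply/measurable_fun_coorP => i; under eq_fun do rewrite mxE.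
by apply: measurable_sum => j; apply: measurable_funM => //; exact: measurable_coor.
Qed.

Definition floor_cV n (y : 'cV[R]_n) : 'cV[int]_n := map_mx Num.floor y.

Lemma floor_cVD n (y : 'cV[R]_n) k : floor_cV (y + int_cV R k) = floor_cV y + k.
Proof.
apply/matrixP => i j; rewrite !mxE floorDrz ?intr_int// intrKfloor//.
Qed.

Lemma floor_cVP n (y : 'cV[R]_n) k : floor_cV y = k <->
  forall i, (k i ord0)%:~R <= y i ord0 < (k i ord0 + 1)%:~R.
Proof.
split=> [<- i|yk]; first by rewrite mxE floor_itv.
by apply/matrixP => i j; rewrite (ord1 j) mxE; apply: floor_def.
Qed.

Variables (d : nat) (P : 'M[R]_d).
Hypothesis uP : P \in unitmx.

(* The translate by P k of the fundamental domain P [0, 1)^d. *)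
Definition cell (k : 'cV[int]_d) : set 'cV[R]_d :=
  [set x | floor_cV (invmx P *m x) = k].

Lemma measurable_cell k : measurable (cell k).
Proof.
rewrite (_ : cell k = (fun x => invmx P *m x) @^-1`
    [set y | forall i, `[(k i ord0)%:~R, (k i ord0 + 1)%:~R[%classic (y i ord0)]).
  rewrite -[X in measurable X]setTI; apply: measurable_mulmx => //.
  exact: (@measurable_box _ _ _
    (fun i => `[(k i ord0)%:~R, (k i ord0 + 1)%:~R[%classic : set R)).
apply/seteqP; split=> x /=.
  by move/floor_cVP => xk i; rewrite in_itv /=; exact: xk.
by move=> xk; apply/floor_cVP => i; have := xk i; rewrite in_itv.
Qed.

Lemma cell_shift j k :
  (fun v => v + P *m int_cV R k) @^-1` cell (j + k) = cell j.
Proof.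
apply/seteqP; split=> x; rewrite /cell /= mulmxDr mulKmx// floor_cVD.
  by move/addIr.
by move=> ->.
Qed.

Lemma lebesgue_cell k : lebesgue_cV R d (cell k) = lebesgue_cV R d (cell 0).
Proof.
by rewrite -(cell_shift 0 k) add0r lebesgue_cV_shift//; exact: measurable_cell.
Qed.

Lemma lebesgue_cell_lty k : (lebesgue_cV R d (cell k) < +oo)%E.
Proof.
rewrite lebesgue_cell.
(* A point of the tile is P y with y in [0, 1)^d, so its i-th coordinate is at most the absolute row
   sum [c i]; a bounded box contains the tile. *)
pose c i := \sum_j `|P i j|.
pose I i : set R := `[- c i, c i]%classic.
pose box := [set v : 'cV[R]_d | forall i, I i (v i ord0)].
have mbox : measurable box.
  by apply: (measurable_box (A := I)) => i; exact: measurable_itv.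
apply: (@le_lt_trans _ _ (lebesgue_cV R d box)).
  apply: le_measure; rewrite ?inE//; first exact: measurable_cell.
  move=> x /floor_cVP x0 i; rewrite /I /= in_itv /= -ler_norml.
  rewrite -[x](mulKVmx uP) mxE (le_trans (ler_norm_sum _ _ _))//.
  apply: ler_sum => j _; rewrite normrM ler_piMr//.
  by have := x0 j; rewrite !mxE add0r => /andP[y0 /ltW y1]; rewrite ger0_norm.
rewrite (lebesgue_cV_box (A := I)); last by move=> i; exact: measurable_itv.
rewrite -ge0_fin_numE; last first.
  by apply: prode_ge0 => i _; exact: measure_ge0.
apply: prode_fin_num => i _; rewrite lebesgue_measure_itv /=.
by case: ifPn.
Qed.

(** Countably many tiles of equal measure cover R^d: if one were null, the unit cube would be null
    too. *)
Lemma lebesgue_cell_gt0 k : (0 < lebesgue_cV R d (cell k))%E.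
Proof.
rewrite lt0e measure_ge0 andbT; apply/eqP => cell0.
(* Enumeration of the tiles by natural numbers, padded with empty sets at numbers that encode no
   integer vector. *)
pose C n := if unpickle n is Some k then cell k else set0.
have mC n : measurable (C n).
  by rewrite /C; case: (unpickle n) => // j; exact: measurable_cell.
have C0 n : lebesgue_cV R d (C n) = 0%E.
  rewrite /C; case: (unpickle n) => [j|]; last exact: measure0.
  by rewrite lebesgue_cell -(lebesgue_cell k).
pose I (i : 'I_d) : set R := `[0, 1]%classic.
pose box := [set v : 'cV[R]_d | forall i, I i (v i ord0)].
have mbox : measurable box.
  by apply: (measurable_box (A := I)) => i; exact: measurable_itv.
have : (lebesgue_cV R d box <= \sum_(n <oo) lebesgue_cV R d (C n))%E.
  apply: measure_sigma_subadditive => // x _.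
  exists (pickle (floor_cV (invmx P *m x))) => //.
  by rewrite /C pickleK.
rewrite eseries0 => [|n _ _]; last exact: C0.
rewrite (lebesgue_cV_box (A := I)); last by move=> i; exact: measurable_itv.
rewrite big1 ?leNgt ?lte01// => i _.
by rewrite lebesgue_measure_itv /= lte_fin ltr01 sube0.
Qed.

End lattice_cells.

(** * Orthogonality of the characters of a cell *)

Section trigonometry.
Context {R : realType}.

Lemma measurable_cosD d (T : measurableType d) (f : T -> R) (a : R) :
  measurable_fun setT f -> measurable_fun setT (fun x => cos (f x + a)).
Proof.
move=> mf; apply: (@measurableT_comp _ _ _ _ _ _ (@cos R)).
  apply: continuous_measurable_fun; exact: continuous_cos.
by apply: measurable_funD.
Qed.

Lemma cosD2piz (a : R) (n : int) : cos (a + 2 * pi * n%:~R) = cos a.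
Proof.
have nat_case (b : R) (m : nat) : cos (b + 2 * pi * m%:R) = cos b.
  by rewrite mulr_natr (mulr_natl pi) (periodicn (@cosD2pi R)).
case: n => n; first exact: nat_case.
by rewrite NegzE mulrNz mulrN -{2}(subrK (2 * pi * n.+1%:~R) a) nat_case.
Qed.

Lemma cosDpi_odd (a : R) (n : int) : cos (a + pi * (2 * n%:~R + 1)) = - cos a.
Proof.
rewrite (_ : _ + _ = (a + pi) + 2 * pi * n%:~R); last by ring.
by rewrite cosD2piz cosDpi.
Qed.

End trigonometry.

(** * Vanishing integrals of antiperiodic functions over a tile *)

Section characters.
Context {R : realType}.
Variables (d : nat) (P : 'M[R]_d).
Hypothesis uP : P \in unitmx.

Let mu := lebesgue_cV R d.

Lemma integrable_bounded_cell k (u : 'cV[R]_d -> R) (M : R) (D : set 'cV[R]_d) :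
  measurable D -> D `<=` cell P k -> 
  measurable_fun setT u -> (forall x, `|u x| <= M) -> mu.-integrable D (EFin \o u).
Proof.
move=> mD Dk mf uM.
apply: measurable_bounded_integrable => //.
- apply: le_lt_trans (lebesgue_cell_lty uP k).
  by apply: le_measure; rewrite ?inE//; exact: measurable_cell.
- exact: measurable_funTS.
- by exists M; split; [exact: num_real|move=> m Mm x _ /=; exact: le_trans (uM x) (ltW Mm)].
Qed.

(* A translation by t, taken modulo 1 in the i-th coordinate with respect to P,
   is implemented by the two translations by t and t - 1. *)
Lemma Rintegral_cell_antiperiodic k (i : 'I_d) (t M : R) (u : 'cV[R]_d -> R) :
  0 < t < 1 -> measurable_fun setT u -> (forall x, `|u x| <= M) ->
  (forall x, u (x + P *m (t *: delta_mx i ord0)) = - u x) ->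
  (forall x, u (x + P *m ((t - 1) *: delta_mx i ord0)) = - u x) ->
  \int[mu]_(x in cell P k) u x = 0.
Proof.
move=> /andP[t0 t1] mf uM ut ut1.
pose y (x : 'cV[R]_d) := (invmx P *m x) i ord0.
have my : measurable_fun setT y.
  exact: measurableT_comp (measurable_coor i) (measurable_mulmx (invmx P)).
pose lo (s : R) := cell P k `&` [set x | y x < (k i ord0)%:~R + s].
pose hi (s : R) := cell P k `&` [set x | (k i ord0)%:~R + s <= y x].
have mlo (s : R) : measurable (lo s).
  apply: measurableI; first exact: measurable_cell.
  rewrite (_ : [set x | _] = y @^-1` `]-oo, (k i ord0)%:~R + s[%classic).
    by rewrite -[X in measurable X]setTI; exact: my.
  by apply/seteqP; split=> x /=; rewrite in_itv.
have mhi (s : R) : measurable (hi s).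
  apply: measurableI; first exact: measurable_cell.
  rewrite (_ : [set x | _] = y @^-1` `[(k i ord0)%:~R + s, +oo[%classic).
    by rewrite -[X in measurable X]setTI; exact: my.
  by apply/seteqP; split=> x /=; rewrite in_itv /= andbT.
have cellE (s : R) : cell P k = lo s `|` hi s.
  rewrite /lo /hi -setIUr [X in _ `&` X](_ : _ = setT) ?setIT//.
  by apply/seteqP; split=> // x _ /=; have [|] := ltP (y x) ((k i ord0)%:~R + s); [left|right].
have split_int (s : R) : \int[mu]_(x in cell P k) u x =
    \int[mu]_(x in lo s) u x + \int[mu]_(x in hi s) u x.
  rewrite {1}(cellE s) Rintegral_setU//.
    apply: (integrable_bounded_cell (k := k)) mf uM; rewrite -cellE //.
    exact: measurable_cell.
  apply/disj_setPS => x [[_ /= h1] [_ /= h2]].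
  by have := lt_le_trans h1 h2; rewrite ltxx.
have shiftE (s : R) (x : 'cV[R]_d) j : (invmx P *m (x + P *m (s *: delta_mx i ord0))) j ord0 =
    (invmx P *m x) j ord0 + s * (j == i)%:R.
  by rewrite mulmxDr mulKmx// !mxE eqxx andbT.
pose others (x : 'cV[R]_d) := forall j, j != i ->
  (k j ord0)%:~R <= (invmx P *m x) j ord0 < (k j ord0)%:~R + 1.
have in_shift (s : R) (x : 'cV[R]_d) : cell P k (x + P *m (s *: delta_mx i ord0)) <->
    others x /\ (k i ord0)%:~R <= y x + s < (k i ord0)%:~R + 1.
  split=> [/floor_cVP xk|[xo xi]].
    split=> [j ji|]; last by have := xk i; rewrite shiftE eqxx mulr1 intrD.
    by have := xk j; rewrite shiftE (negbTE ji) mulr0 addr0 intrD.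
  apply/floor_cVP => j; rewrite shiftE intrD.
  by have [->|ji] := eqVneq j i; rewrite ?mulr1// mulr0 addr0 xo.
have yshift (s : R) (x : 'cV[R]_d) : y (x + P *m (s *: delta_mx i ord0)) = y x + s.
  by rewrite /y shiftE eqxx mulr1.
have in_cell (x : 'cV[R]_d) : cell P k x <->
    others x /\ (k i ord0)%:~R <= y x < (k i ord0)%:~R + 1.
  by have := in_shift 0 x; rewrite scale0r mulmx0 !addr0.
have anti (s : R) (D E : set 'cV[R]_d) : measurable D -> D `<=` cell P k ->
    (forall x, u (x + P *m (s *: delta_mx i ord0)) = - u x) ->
    (fun v => v + P *m (s *: delta_mx i ord0)) @^-1` D = E ->
    measurable E -> E `<=` cell P k ->
    \int[mu]_(x in D) u x = - \int[mu]_(x in E) u x.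
  move=> mD Dk us DE mE Ek.
  rewrite /Rintegral -(integral_cV_shift (P *m (s *: delta_mx i ord0)))//; first last.
  - exact: integrable_bounded_cell mD Dk mf uM.
  - exact/measurable_EFinP.
  rewrite DE /=; under eq_integral => x _ do rewrite us EFinN.
  rewrite integralN ?fineN//; apply: integrable_add_def => //.
  exact: (integrable_bounded_cell mE Ek mf uM).
(* The translation by t carries [lo (1 - t)] onto [hi t], and the translation by t - 1 carries
   [hi (1 - t)] onto [lo t]. Both change the sign of [u], so the two splittings of the tile show
   that the integral is its own negative. *)
have tsum : \int[mu]_(x in cell P k) u x = - \int[mu]_(x in cell P k) u x.
  rewrite {1}(split_int t) (split_int (1 - t)) opprD addrC.
  congr (_ + _).
    apply: (anti t) => //; try exact: subIsetl.
    apply/seteqP; split=> x [xk /= xt]; split => /=.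
    + by case/in_shift: xk => xo xi; apply/in_cell; split=> //; move: xt; rewrite yshift; lra.
    + by case/in_shift: xk => xo xi; lra.
    + by case/in_cell: xk => xo xi; apply/in_shift; split=> //; lra.
    + by case/in_cell: xk => xo xi; rewrite yshift; lra.
  apply: (anti (t - 1)) => //; try exact: subIsetl.
  apply/seteqP; split=> x [xk /= xt]; split => /=.
  + by case/in_shift: xk => xo xi; apply/in_cell; split=> //; move: xt; rewrite yshift; lra.
  + by case/in_shift: xk => xo xi; lra.
  + by case/in_cell: xk => xo xi; apply/in_shift; split=> //; lra.
  + by case/in_cell: xk => xo xi; rewrite yshift; lra.
lra.
Qed.
End characters.

Section dual_characters.
Context {R : realType}.
Variables (d : nat) (P : 'M[R]_d).
Hypothesis uP : P \in unitmx.

Let mu := lebesgue_cV R d.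

Lemma dotprodE n (a x : 'cV[R]_n) : dotprod a x = (a^T *m x) ord0 ord0.
Proof. by rewrite mxE; apply: eq_bigr => i _; rewrite mxE. Qed.

Lemma dotprodDl n (a b x : 'cV[R]_n) :
  dotprod (a + b) x = dotprod a x + dotprod b x.
Proof. by rewrite -big_split; apply: eq_bigr => i _; rewrite mxE mulrDl. Qed.

Lemma dotprodNl n (a x : 'cV[R]_n) : dotprod (- a) x = - dotprod a x.
Proof. by rewrite -sumrN; apply: eq_bigr => i _; rewrite mxE mulNr. Qed.

Lemma measurable_dotprod n (a : 'cV[R]_n) : measurable_fun setT (dotprod a).
Proof.
apply: measurable_sum => i.
by apply: measurable_funM => //; exact: measurable_coor.
Qed.

Definition dual_point (l : 'cV[int]_d) : 'cV[R]_d := (invmx P)^T *m int_cV R l.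

Lemma dotprod_dual l (x : 'cV[R]_d) :
  dotprod (dual_point l) x = dotprod (int_cV R l) (invmx P *m x).
Proof. by rewrite !dotprodE trmx_mul trmxK mulmxA. Qed.

Lemma dual_pointD k l : dual_point (k + l) = dual_point k + dual_point l.
Proof. by rewrite /dual_point /int_cV map_mxD mulmxDr. Qed.

Lemma dual_pointN l : dual_point (- l) = - dual_point l.
Proof. by rewrite /dual_point /int_cV map_mxN mulmxN. Qed.

Lemma dual_point0 : dual_point 0 = 0.
Proof. by rewrite /dual_point /int_cV map_mx0 mulmx0. Qed.

Lemma dotprod_int_delta n (l : 'cV[int]_n) (s : R) i :
  dotprod (int_cV R l) (s *: delta_mx i ord0) = s * (l i ord0)%:~R.
Proof.
rewrite /dotprod (bigD1 i)//= big1 ?addr0 => [|j /negbTE ji].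
  by rewrite !mxE !eqxx mulr1 mulrC.
by rewrite !mxE ji mulr0 mulr0.
Qed.

(** The free phase [a] lets one family of cosines cover both the real and the imaginary parts of the
    characters, and makes a product of two members half the sum of two others. *)
Definition trig_char l (a : R) (x : 'cV[R]_d) : R :=
  cos (2 * pi * dotprod (dual_point l) x + a).

Lemma measurable_trig_char l a : measurable_fun setT (trig_char l a).
Proof.
apply: measurable_cosD; apply: measurable_funM => //.
exact: measurable_dotprod.
Qed.

Lemma trig_char_bounded l a x : `|trig_char l a x| <= 1.
Proof. by rewrite ler_norml cos_geN1 cos_le1. Qed.

(** If m is a nonzero i-th entry of l, moving by s in the i-th coordinate adds 2 pi s m to the
    phase. For s = 1 / (2|m|) this is pi or -pi, and for s - 1 it differs from that by a multiple of
    2 pi: both translations are antiperiods. *)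
Lemma Rintegral_cell_trig_char k l a : l != 0 ->
  \int[mu]_(x in cell P k) trig_char l a x = 0.
Proof.
move=> l0.
have [i li] : exists i, l i ord0 != 0.
  apply/existsP; apply: contra_neqT l0; rewrite negb_exists => /forallP l0.
  by apply/matrixP => i j; rewrite (ord1 j) mxE; apply/eqP; rewrite -[_ == _]negbK l0.
pose m : R := (l i ord0)%:~R.
have m1 : 1 <= `|m| by rewrite -intr_norm -[1]/(1%:~R) ler_int -gtz0_ge1 normr_gt0.
(* The sign of m, written as an odd integer to fit [cosDpi_odd]. *)
have [n mn] : exists n : int, m / `|m| = 2 * n%:~R + 1.
  have [m0|m0] := leP 0 m.
    by exists 0; rewrite ger0_norm// divff ?intr_eq0//; ring.
  by exists (-1); rewrite ltr0_norm// invrN mulrN divff ?intr_eq0//; ring.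
have shift s x (q : int) : 2 * s * m = 2 * q%:~R + 1 ->
    trig_char l a (x + P *m (s *: delta_mx i ord0)) = - trig_char l a x.
  move=> sq; rewrite /trig_char -(cosDpi_odd _ q) !dotprod_dual -sq mulmxDr mulKmx//.
  rewrite !dotprodE mulmxDr mxE -!dotprodE dotprod_int_delta -/m; congr cos; ring.
apply: (@Rintegral_cell_antiperiodic _ _ _ uP k i (2 * `|m|)^-1 1).
- have m0 : 0 < 2 * `|m| by lra.
  by rewrite invr_gt0 m0 invf_lt1//=; lra.
- exact: measurable_trig_char.
- exact: trig_char_bounded.
- by move=> x; apply: (shift _ _ n); rewrite -mn invfM; field; lra.
- move=> x; apply: (shift _ _ (n - l i ord0)).
  rewrite intrB -/m (_ : 2 * (_ - m) + 1 = m / `|m| - 2 * m).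
    by field; lra.
  by rewrite mn; ring.
Qed.

End dual_characters.

(** * Trigonometric approximation of bounded measurable functions *)

Section smoothstep.
Context {R : realType}.

(** An odd cubic with fixed points -1, 0 and 1, the outer two attracting: its iterates are
    polynomials that converge to the sign function on [-1, 1]. *)
Definition smoothstep (v : R) : R := 3 / 2 * v - 1 / 2 * v ^+ 3.

Lemma iter_smoothstepN n v : iter n smoothstep (- v) = - iter n smoothstep v.
Proof. by elim: n => //= n ->; rewrite /smoothstep; ring. Qed.

Lemma iter_smoothstep_itv n v : 0 < v <= 1 -> v <= iter n smoothstep v <= 1.
Proof.
move=> v01; elim: n => [|n] /=; first by case/andP: v01 => _ ->; rewrite lexx.
move: (iter n _ _) => w /andP[vw w1].
rewrite /smoothstep; apply/andP; split.
  apply: (le_trans vw); rewrite -subr_ge0.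
  rewrite (_ : _ - w = w / 2 * ((1 - w) * (1 + w))); last by field.
  by rewrite !mulr_ge0//; lra.
rewrite -subr_ge0 (_ : 1 - _ = (1 - w) ^+ 2 * (2 + w) / 2); last by field.
by rewrite !mulr_ge0 ?sqr_ge0//; lra.
Qed.

(** One step multiplies the distance 1 - w by (1 - w)(2 + w) / 2 = 1 - (w + w^2) / 2, which is at
    most 1 - v / 2 because the iterates stay above v. *)
Lemma iter_smoothstep_ge n v :
  0 < v <= 1 -> 1 - (1 - v / 2) ^+ n <= iter n smoothstep v.
Proof.
move=> v01; elim: n => [|n IH].
  by rewrite expr0 subrr /=; lra.
have := iter_smoothstep_itv n v01; rewrite iterS.
move: (iter n _ _) IH => w IH /andP[vw w1].
rewrite lerBlDr -lerBlDl exprS.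
rewrite (_ : 1 - _ = (1 - w) * ((1 - w) * (2 + w) / 2)); last by rewrite /smoothstep; field.
apply: (@le_trans _ _ ((1 - v / 2) * (1 - w))).
  by rewrite mulrC ler_wpM2r; [|lra|nra].
by rewrite ler_wpM2l; lra.
Qed.

Lemma cvg_iter_smoothstep v : 0 < v <= 1 ->
  iter n smoothstep v @[n --> \oo] --> (1 : R).
Proof.
move=> v01; apply: (@squeeze_cvgr _ _ _ _ (fun n => 1 - (1 - v / 2) ^+ n) (fun=> 1)).
- by apply: nearW => n; rewrite iter_smoothstep_ge//; case/andP: (iter_smoothstep_itv n v01).
- rewrite -[X in _ --> X]subr0; apply: cvgB; first exact: cvg_cst.
  by apply: cvg_expr; rewrite ger0_norm; lra.
- exact: cvg_cst.
Qed.

Lemma norm_iter_smoothstep n v : `|v| <= 1 -> `|iter n smoothstep v| <= 1.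
Proof.
move=> v1; have [v0|v0|<-] := ltgtP 0 v.
- have v01 : 0 < v <= 1 by rewrite v0 -(gtr0_norm v0).
  have /andP[h1 h2] := iter_smoothstep_itv n v01.
  by rewrite ger0_norm//; lra.
- have v01 : 0 < - v <= 1 by rewrite oppr_gt0 v0 -(ltr0_norm v0).
  have := iter_smoothstep_itv n v01; rewrite iter_smoothstepN => /andP[h1 h2].
  by rewrite ler0_norm//; lra.
- have := iter_smoothstepN n 0; rewrite oppr0 => h.
  by rewrite (_ : iter _ _ _ = 0) ?normr0//; lra.
Qed.

(** The polynomial (s + s^2) / 2 sends -1 and 0 to 0 and 1 to 1, so it turns the limiting sign into
    the indicator of the positive numbers. *)
Definition smooth_pos n (v : R) : R :=
  1 / 2 * (iter n smoothstep v + iter n smoothstep v * iter n smoothstep v).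

Lemma norm_smooth_pos n v : `|v| <= 1 -> `|smooth_pos n v| <= 1.
Proof.
move=> /(norm_iter_smoothstep n); rewrite /smooth_pos !ler_norml; nra.
Qed.

Lemma cvg_smooth_pos v : `|v| <= 1 ->
  smooth_pos n v @[n --> \oo] --> ((0 < v)%R%:R : R).
Proof.
move=> v1.
have lim (s : R) : iter n smoothstep v @[n --> \oo] --> s ->
    smooth_pos n v @[n --> \oo] --> 1 / 2 * (s + s * s).
  move=> vs; apply: cvgM; first exact: cvg_cst.
  by apply: cvgD => //; exact: cvgM.
have [v0|v0|v0] := ltgtP 0 v.
- rewrite (_ : 1%:R = 1 / 2 * (1 + 1 * 1)); last by field.
  by apply/lim/cvg_iter_smoothstep; rewrite v0 -(gtr0_norm v0).
- rewrite (_ : 0%:R = 1 / 2 * (- 1 + (- 1) * (- 1))); last by field.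
  have v01 : 0 < - v <= 1 by rewrite oppr_gt0 v0 -(ltr0_norm v0).
  apply: lim; rewrite (_ : (fun n => iter n smoothstep v) =
      fun n => - iter n smoothstep (- v)).
    by apply: cvgN; exact: cvg_iter_smoothstep.
  by apply/funext => n; rewrite iter_smoothstepN opprK.
- rewrite (_ : 0%:R = 1 / 2 * (0 + 0 * 0)); last by ring.
  apply: lim; rewrite -v0 (_ : (fun n => iter n _ _) = fun=> 0); first exact: cvg_cst.
  by apply/funext => n; have := iter_smoothstepN n 0; rewrite oppr0 => h; lra.
Qed.

End smoothstep.

(** * The algebra generated by the real characters under bounded limits *)

Section trig_closure.
Context {R : realType}.
Variables (d : nat) (P : 'M[R]_d).

(* Closing the real characters under bounded pointwise limits, rather than under
   L2 limits, makes the result an algebra that contains the indicator functions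
   of a sigma-algebra. *)
Inductive trig_closure (D : set 'cV[R]_d) : ('cV[R]_d -> R) -> Prop :=
| Trig_char l a : trig_closure D (trig_char P l a)
| Trig_add u v : trig_closure D u -> trig_closure D v ->
    trig_closure D (fun x => u x + v x)
| Trig_scale c u : trig_closure D u -> trig_closure D (fun x => c * u x)
| Trig_lim (U : nat -> 'cV[R]_d -> R) (u : 'cV[R]_d -> R) (M : R) :
    (forall n, trig_closure D (U n)) ->
    measurable_fun setT u -> (forall n x, D x -> `|U n x| <= M) ->
    (forall x, D x -> U n x @[n --> \oo] --> u x) -> trig_closure D u.

Variable D : set 'cV[R]_d.

Lemma trig_closure_measurable u : trig_closure D u -> measurable_fun setT u.
Proof.
elim=> // [l a|v w _ mv _ mw|c v _ mv].
- exact: measurable_trig_char.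
- exact: measurable_funD.
- exact: measurable_funM.
Qed.

Lemma trig_closure_bounded u : trig_closure D u ->
  exists M, forall x, D x -> `|u x| <= M.
Proof.
elim=> [l a|v w _ [M vM] _ [N wN]|c v _ [M vM]|U v M _ _ _ UM Uv].
- by exists 1 => x _; exact: trig_char_bounded.
- by exists (M + N) => x Dx; rewrite (le_trans (ler_normD _ _))// lerD ?vM ?wN.
- by exists (`|c| * M) => x Dx; rewrite normrM ler_wpM2l ?vM.
- exists M => x Dx.
  have Uvx : `|U n x| @[n --> \oo] --> `|v x| by apply: cvg_norm; exact: Uv.
  apply: (closed_cvg (fun y => y <= M) _ _ _ Uvx); first exact: closed_le.
  by apply: nearW => n; exact: UM.
Qed.

(** The constant sequence [u] converges to [v] on [D], so [Trig_lim] applies: only the values on [D]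
    matter, while measurability is asked for on the whole space. *)
Lemma trig_closure_eq u v : trig_closure D u -> measurable_fun setT v ->
  (forall x, D x -> u x = v x) -> trig_closure D v.
Proof.
move=> Du mv uv; have [M uM] := trig_closure_bounded Du.
apply: (@Trig_lim _ (fun=> u) _ M) => // x Dx.
by rewrite -uv//; exact: cvg_cst.
Qed.

Lemma trig_closure_cst c : trig_closure D (fun=> c).
Proof.
apply: (@trig_closure_eq (fun x => c * trig_char P 0 0 x)) => // [|x _].
  exact/Trig_scale/Trig_char.
by rewrite /trig_char dual_point0 dotprodE trmx0 mul0mx mxE mulr0 addr0 cos0 mulr1.
Qed.

(** The product-to-sum formula for cosines settles the base case; multiplication by a function
    bounded by 1 respects sums, multiples and bounded limits. *)
Lemma trig_closure_mul_char l a v :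
  trig_closure D v -> trig_closure D (fun x => trig_char P l a x * v x).
Proof.
elim=> [k b|{}v w _ IHv _ IHw|c {}v _ IHv|U {}v M _ IHU mv UM Uv].
- rewrite (_ : (fun x => _) = fun x => 1 / 2 * (trig_char P (l + k) (a + b) x +
      trig_char P (l - k) (a - b) x)).
    by apply: Trig_scale; apply: Trig_add; exact: Trig_char.
  apply/funext => x; rewrite /trig_char !dual_pointD dual_pointN !dotprodDl dotprodNl.
  set y := dotprod _ _; set z := dotprod _ _.
  rewrite (_ : _ * (y + z) + _ = (2 * pi * y + a) + (2 * pi * z + b)); last by ring.
  rewrite (_ : _ * (y - z) + _ = (2 * pi * y + a) - (2 * pi * z + b)); last by ring.
  by move: (_ + a) (_ + b) => s t; rewrite cosD cosB; field.
- rewrite (_ : (fun x => _) = fun x => trig_char P l a x * v x + trig_char P l a x * w x).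
    exact: Trig_add.
  by apply/funext => x; rewrite mulrDr.
- rewrite (_ : (fun x => _) = fun x => c * (trig_char P l a x * v x)).
    exact: Trig_scale.
  by apply/funext => x; rewrite mulrCA.
- apply: (Trig_lim (M := M) IHU).
  + by apply: measurable_funM => //; exact: measurable_trig_char.
  + move=> n x Dx; rewrite normrM (le_trans _ (UM n x Dx))//.
    by rewrite ler_piMl// trig_char_bounded.
  + by move=> x Dx; apply: cvgM; [exact: cvg_cst|exact: Uv].
Qed.

(** The induction is on one factor only: [trig_closure_mul_char] is its base case, and a bound on
    the other factor keeps the limits bounded. *)
Lemma trig_closureM u v :
  trig_closure D u -> trig_closure D v -> trig_closure D (fun x => u x * v x).
Proof.
move=> + Dv; have mv := trig_closure_measurable Dv.
have [N vN] := trig_closure_bounded Dv.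
elim=> [k b|{}u w _ IHu _ IHw|c {}u _ IHu|U {}u M _ IHU mu UM Uu].
- exact: trig_closure_mul_char.
- rewrite (_ : (fun x => _) = fun x => u x * v x + w x * v x); first exact: Trig_add.
  by apply/funext => x; rewrite mulrDl.
- rewrite (_ : (fun x => _) = fun x => c * (u x * v x)); first exact: Trig_scale.
  by apply/funext => x; rewrite mulrA.
- apply: (Trig_lim (M := M * N) IHU); first exact: measurable_funM.
    by move=> n x Dx; rewrite normrM ler_pM// ?UM ?vN.
  by move=> x Dx; apply: cvgM; [exact: Uu|exact: cvg_cst].
Qed.

Lemma trig_closure_smooth_pos n u :
  trig_closure D u -> trig_closure D (fun x => smooth_pos n (u x)).
Proof.
move=> Du.
have Di : trig_closure D (fun x => iter n smoothstep (u x)).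
  elim: n => //= n IHn.
  rewrite (_ : (fun x => _) = fun x => 3 / 2 * iter n smoothstep (u x) + (- (1 / 2)) *
      (iter n smoothstep (u x) * (iter n smoothstep (u x) * iter n smoothstep (u x)))).
    by apply: Trig_add; apply: Trig_scale => //; do !apply: trig_closureM.
  by apply/funext => x; rewrite /smoothstep; ring.
by apply: Trig_scale; apply: Trig_add => //; exact: trig_closureM.
Qed.

Lemma trig_closure_pos u : trig_closure D u -> (forall x, D x -> `|u x| <= 1) ->
  trig_closure D (\1_[set x | 0 < u x]).
Proof.
move=> Du u1; have mu := trig_closure_measurable Du.
apply: (@Trig_lim _ (fun n x => smooth_pos n (u x)) _ 1).
- by move=> n; exact: trig_closure_smooth_pos.
- apply: measurable_indic; rewrite (_ : [set x | _] = u @^-1` `]0, +oo[%classic).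
    by rewrite -[X in measurable X]setTI; exact: mu.
  by apply/seteqP; split=> x /=; rewrite in_itv /= andbT.
- by move=> n x Dx; exact/norm_smooth_pos/u1.
- move=> x Dx; rewrite indicE mem_setE.
  exact/cvg_smooth_pos/u1.
Qed.

End trig_closure.

Lemma indic_predE (T : Type) (R : pzRingType) (b : T -> bool) (x : T) :
  \1_[set y | b y] x = (b x)%:R :> R.
Proof.
by rewrite indicE; congr (_%:R); congr nat_of_bool; apply/idP/idP; rewrite inE.
Qed.

Import HBSimple HBNNSimple.

(** * Bounded measurable functions belong to the closure *)

Section trig_closure_density.
Context {R : realType}.
Variables (d : nat) (P : 'M[R]_d).
Hypothesis uP : P \in unitmx.

Let coords (x : 'cV[R]_d) : 'cV[R]_d := invmx P *m x.

Let measurable_coords : measurable_fun setT coords.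
Proof. exact: measurable_mulmx. Qed.

Let measurable_coords_preimage E : measurable E -> measurable (coords @^-1` E).
Proof. by move=> mE; rewrite -[X in measurable X]setTI; exact: measurable_coords. Qed.

(** Complements come from 1 - u, finite unions from u + v - u v, and countable unions are bounded
    limits of finite ones. Measurability is carried along because [Trig_lim] demands it of the
    limit. *)
Lemma sigma_algebra_trig_closure D : sigma_algebra setT
  [set E | measurable E /\ trig_closure P D (\1_(coords @^-1` E))].
Proof.
split=> [|E [mE DE]|F DF] /=.
- split=> //; rewrite preimage_set0 indic0; exact: trig_closure_cst.
- split; first by rewrite setTD; exact: measurableC.
  rewrite (_ : \1_ _ = fun x => 1 + (- 1) * \1_(coords @^-1` E) x).
    by apply: Trig_add; [exact: trig_closure_cst|exact: Trig_scale].
  apply/funext => x; rewrite !indicE setTD preimage_setC in_setC.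
  by case: (_ \in _) => /=; ring.
- have mF i : measurable (F i) by case: (DF i).
  split; first exact: bigcupT_measurable.
  pose G n := \big[setU/set0]_(i < n) F i.
  apply: (@Trig_lim _ _ _ _ (fun n => \1_(coords @^-1` G n)) _ 1).
  + elim=> [|n IHn].
      by rewrite /G big_ord0 preimage_set0 indic0; exact: trig_closure_cst.
    have [_ Dn] := DF n.
    rewrite (_ : \1_ _ = fun x => (\1_(coords @^-1` G n) x + \1_(coords @^-1` F n) x) +
        (- 1) * (\1_(coords @^-1` G n) x * \1_(coords @^-1` F n) x)).
      by apply: Trig_add; [exact: Trig_add|apply: Trig_scale; exact: trig_closureM].
    apply/funext => x; rewrite !indicE /G big_ord_recr /= preimage_setU in_setU.
    by case: (_ \in _); case: (_ \in _) => /=; ring.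
  + apply: measurable_indic; apply: measurable_coords_preimage.
    exact: bigcupT_measurable.
  + move=> n x _; rewrite indicE; case: (_ \in _); rewrite ?normr1 ?normr0//.
  + move=> x _; apply: cvg_near_cst; rewrite !indicE.
    have [[i _ Fi]|nF] := pselect ((\bigcup_n F n) (coords x)).
      exists i.+1 => // n /= ni; rewrite indicE !mem_set//=; first by exists i.
      by rewrite /G -bigcup_mkord; exists i.
    apply: nearW => n; rewrite indicE !memNset// => Gx; apply: nF.
    by move: Gx; rewrite /G -bigcup_mkord => -[i _ Fi]; exists i.
Qed.

(** In the coordinate z, sin (pi (z - a)) changes sign at a but has period 2, so it is no character
    of the tile. Multiplied by sin (pi (z - m)), which is positive for m < z < m + 1, it becomes a
    constant plus a multiple of a character of frequency 1. *)
Lemma trig_closure_halfspace k i a :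
  trig_closure P (cell P k) (\1_(coords @^-1` [set y | a < y i ord0])).
Proof.
have mI : measurable_fun setT (\1_(coords @^-1` [set y : 'cV[R]_d | a < y i ord0]) : _ -> R).
  apply: measurable_indic; apply: measurable_coords_preimage.
  rewrite (_ : [set y | _] = (fun y : 'cV[R]_d => y i ord0) @^-1` `]a, +oo[%classic).
    by rewrite -[X in measurable X]setTI; exact: measurable_coor.
  by apply/seteqP; split=> x /=; rewrite in_itv /= andbT.
pose m : R := (k i ord0)%:~R.
have cellP x : cell P k x -> m <= coords x i ord0 < m + 1.
  by move/floor_cVP => /(_ i); rewrite intrD.
have [am|ma] := ltP a m.
  apply: (trig_closure_eq (trig_closure_cst P _ 1) mI) => x /cellP xk.
  by rewrite indicE mem_set//= (lt_le_trans am)//; case/andP: xk.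
have [m1a|am1] := leP (m + 1) a.
  apply: (trig_closure_eq (trig_closure_cst P _ 0) mI) => x /cellP xk.
  by rewrite indicE memNset//= => ax; lra.
(* By vE this trigonometric polynomial is positive on the cell exactly when the
   i-th coordinate exceeds a. *)
pose v x := 1 / 2 * cos (pi * (a - m)) +
  (- (1 / 2)) * trig_char P (delta_mx i ord0) (- (pi * (a + m))) x.
have vE x : v x = sin (pi * (coords x i ord0 - m)) * sin (pi * (coords x i ord0 - a)).
  rewrite /v /trig_char dotprod_dual -/(coords x).
  rewrite (_ : dotprod _ _ = coords x i ord0); last first.
    rewrite /dotprod (bigD1 i)//= big1 ?addr0 => [|j /negbTE ji].
      by rewrite !mxE !eqxx mul1r.
    by rewrite !mxE ji mul0r.
  move: (coords x i ord0) => z.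
  rewrite (_ : pi * (a - m) = pi * (z - m) - pi * (z - a)); last by ring.
  rewrite (_ : 2 * pi * _ - _ = pi * (z - m) + pi * (z - a)); last by ring.
  by move: (pi * (z - m)) (pi * (z - a)) => s t; rewrite cosB cosD; field.
have v1 x : `|v x| <= 1.
  have h y : `|sin y : R| <= 1 by rewrite ler_norml sin_geN1 sin_le1.
  by rewrite vE normrM -[1]mulr1 ler_pM.
apply: (@trig_closure_eq _ _ _ _ (\1_[set x | 0 < v x])) => //.
  apply: trig_closure_pos => //; apply: Trig_add; first exact: trig_closure_cst.
  by apply: Trig_scale; exact: Trig_char.
move=> x /cellP /andP[mx xm]; rewrite (indic_predE _ (fun y => a < coords y i ord0)).
rewrite (indic_predE _ (fun y => 0 < v y)) vE; congr (nat_of_bool _)%:R.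
set y := coords x i ord0 in mx xm *.
have pi0 := @pi_gt0 R.
have sin_pos (t : R) : 0 < t < 1 -> 0 < sin (pi * t).
  move=> /andP[t0 t1]; apply: sin_gt0_pi; rewrite mulr_gt0//=.
  by rewrite -[X in _ < X]mulr1 ltr_pM2l.
(* On the face z = m the product vanishes, in agreement with the indicator since m <= a. *)
have [my|ym] := ltP m y; last first.
  rewrite (_ : y = m) ?subrr ?mulr0 ?sin0 ?mul0r ?ltxx; last by lra.
  by apply/esym/negbTE; rewrite -leNgt.
rewrite pmulr_rgt0; last by apply: sin_pos; lra.
have [ay|ya|->] := ltgtP a y.
- by apply: sin_pos; lra.
- rewrite -opprB mulrN sinN oppr_gt0; apply/negbTE; rewrite -leNgt ltW//.
  by apply: sin_pos; lra.
- by rewrite subrr mulr0 sin0 ltxx.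
Qed.

(** Open half-lines generate the Borel sets of R, and preimages under the coordinates generate those
    of R^d; the sigma-algebra of good sets contains both kinds of generators. *)
Lemma trig_closure_indic k E : measurable E -> trig_closure P (cell P k) (\1_E).
Proof.
move=> mE.
pose S := [set E | measurable E /\ trig_closure P (cell P k) (\1_(coords @^-1` E))].
have [S0 SC SU] : sigma_algebra setT S := sigma_algebra_trig_closure (cell P k).
have coor_set i (A : set R) : measurable A -> S [set y | A (y i ord0)].
  suff gen : (@RGenOInfty.G R).-sigma.-measurable `<=`
      [set A | S [set y : 'cV[R]_d | A (y i ord0)]].
    by move=> mA; apply: gen; rewrite -RGenOInfty.measurableE; exact: mA.
  apply: smallest_sub => [|_ [a ->]].
    split=> // [B|F DF]; first by move/SC; rewrite !setTD.
    exact: SU DF.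
  have halfE : [set y : 'cV[R]_d | `]a, +oo[%classic (y i ord0)] = [set y | a < y i ord0].
    by apply/seteqP; split=> x /=; rewrite in_itv /= andbT.
  suff : S [set y : 'cV[R]_d | a < y i ord0] by rewrite -halfE.
  split; last exact: trig_closure_halfspace.
  rewrite -halfE -[X in measurable X]setTI.
  by apply: (measurable_coor i) => //; exact: measurable_itv.
have all_sets (F : set 'cV[R]_d) : measurable F -> S F.
  apply: smallest_sub; first exact: sigma_algebra_trig_closure.
  move=> B; rewrite -bigcup_seq => -[i _ [A mA <-]] /=; rewrite setTI.
  exact: coor_set.
(* Good sets are described in the coordinates P^-1 x, so the set to be tested is the preimage of [E]
   under P. *)
have [] := all_sets ((fun y : 'cV[R]_d => P *m y) @^-1` E).
  by rewrite -[X in measurable X]setTI; exact: measurable_mulmx.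
move=> _; rewrite -comp_preimage (_ : _ \o coords = id) ?preimage_id//.
by apply/funext => x /=; rewrite mulKVmx.
Qed.

(** The shifted function u + M is nonnegative, hence an increasing limit of simple functions, all
    bounded by 2 M. *)
Lemma trig_closure_dense k (u : 'cV[R]_d -> R) (M : R) :
  measurable_fun setT u -> (forall x, `|u x| <= M) -> trig_closure P (cell P k) u.
Proof.
move=> mu uM.
pose f x := (u x + M)%:E.
have mf : measurable_fun setT f.
  by apply/measurable_EFinP; apply: measurable_funD.
have f0 x : (0 <= f x)%E.
  by rewrite lee_fin -lerBlDr sub0r; have := uM x; rewrite ler_norml => /andP[].
pose g := nnsfun_approx measurableT mf.
have gf x : g n x @[n --> \oo] --> u x + M.
  have := cvg_nnsfun_approx measurableT mf (fun x _ => f0 x) (x := x) I.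
  exact: fine_cvg.
have g0 n x : 0 <= g n x by [].
have gM n x : g n x <= u x + M.
  have := @nondecreasing_cvgn_le _ (fun n => g n x) _ (cvgP _ (gf x)) n.
  rewrite (cvg_lim _ (gf x))//; apply.
  by move=> a b ab; exact/lefP/nd_nnsfun_approx.
rewrite (_ : u = fun x => (u x + M) + (- M)); last by apply/funext => x; rewrite addrK.
apply: Trig_add; last exact: trig_closure_cst.
apply: (@Trig_lim _ _ _ _ (fun n => g n) _ (M + M)) => [n|||x _].
- rewrite (_ : NonNegSimpleFun.sort (g n) =
    fun x => \sum_(y \in range (g n)) y * \1_(g n @^-1` [set y]) x); last first.
    by apply/funext => x; rewrite fimfunE.
  under eq_fun do rewrite fsbig_finite//.
  elim: (finmap.enum_fset _) => [|y s IHs].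
    under eq_fun do rewrite big_nil.
    exact: trig_closure_cst.
  under eq_fun do rewrite big_cons.
  by apply: Trig_add => //; apply: Trig_scale; exact: trig_closure_indic.
- exact/measurable_EFinP.
- move=> n x _; rewrite ger0_norm// (le_trans (gM n x))//.
  by rewrite lerD2r; have := uM x; rewrite ler_norml => /andP[].
- exact: gf.
Qed.

End trig_closure_density.

(** * Closed subspaces of L2 *)

Section complex_valued.
Context {R : realType} {d : nat}.
Local Open Scope complex_scope.
Implicit Types (z w : R[i]) (f g h : 'cV[R]_d -> R[i]).

Definition nsq z : R := complex.Re z ^+ 2 + complex.Im z ^+ 2.

Lemma nsq_ge0 z : 0 <= nsq z.
Proof. by rewrite addr_ge0 ?sqr_ge0. Qed.

Lemma nsq0 : nsq 0 = 0.
Proof. by rewrite /nsq /= expr0n addr0. Qed.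

Lemma Re_mulc z w : complex.Re (z * w) =
  complex.Re z * complex.Re w - complex.Im z * complex.Im w.
Proof. by case: z w => [a b] [a' b']. Qed.

Lemma Im_mulc z w : complex.Im (z * w) =
  complex.Re z * complex.Im w + complex.Im z * complex.Re w.
Proof. by case: z w => [a b] [a' b']. Qed.

Lemma Re_addc z w : complex.Re (z + w) = complex.Re z + complex.Re w.
Proof. by case: z w => [a b] [a' b']. Qed.

Lemma Im_addc z w : complex.Im (z + w) = complex.Im z + complex.Im w.
Proof. by case: z w => [a b] [a' b']. Qed.

Lemma nsqM z w : nsq (z * w) = nsq z * nsq w.
Proof. by rewrite /nsq Re_mulc Im_mulc; ring. Qed.

Lemma nsqD_le z w : nsq (z + w) <= 2 * nsq z + 2 * nsq w.
Proof.
rewrite /nsq Re_addc Im_addc -subr_ge0.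
rewrite (_ : _ - _ = (complex.Re z - complex.Re w) ^+ 2 +
  (complex.Im z - complex.Im w) ^+ 2); last by ring.
by rewrite addr_ge0 ?sqr_ge0.
Qed.

Lemma nsq_real (a : R) : nsq a%:C = a ^+ 2.
Proof. by rewrite /nsq /= expr0n addr0. Qed.

Lemma nsq_expi (a : R) : nsq (expi a) = 1.
Proof. exact: cos2Dsin2. Qed.

Lemma expiD (a b : R) : expi (a + b) = expi a * expi b.
Proof.
apply/eqP; rewrite eq_complex Re_mulc Im_mulc /= cosD sinD eqxx /=.
by apply/eqP; ring.
Qed.

Lemma expi0 : expi 0 = 1 :> R[i].
Proof. by rewrite /expi cos0 sin0. Qed.

Lemma measurable_complexD f g : measurable_complex f -> measurable_complex g ->
  measurable_complex (fun x => f x + g x).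
Proof.
move=> [mf1 mf2] [mg1 mg2]; split.
  by under eq_fun do rewrite Re_addc; apply: measurable_funD.
by under eq_fun do rewrite Im_addc; apply: measurable_funD.
Qed.

Lemma measurable_complexM f g : measurable_complex f -> measurable_complex g ->
  measurable_complex (fun x => f x * g x).
Proof.
move=> [mf1 mf2] [mg1 mg2]; split.
  by under eq_fun do rewrite Re_mulc; apply: measurable_funB; exact: measurable_funM.
by under eq_fun do rewrite Im_mulc; apply: measurable_funD; exact: measurable_funM.
Qed.

Lemma measurable_complex_cst z : measurable_complex (fun=> z : R[i]) (d := d).
Proof. by split; exact: measurable_cst. Qed.

Lemma measurable_complex_real (u : 'cV[R]_d -> R) :
  measurable_fun setT u -> measurable_complex (fun x => (u x)%:C).
Proof. by move=> mu; split=> //=; exact: measurable_cst. Qed.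

Lemma measurable_complexB f g : measurable_complex f -> measurable_complex g ->
  measurable_complex (fun x => f x - g x).
Proof.
move=> mf mg; rewrite (_ : (fun x => _) = fun x => f x + (- 1) * g x).
  by apply: measurable_complexD => //; apply: measurable_complexM => //;
    exact: measurable_complex_cst.
by apply/funext => x; rewrite mulN1r.
Qed.

Lemma measurable_complex_expi (u : 'cV[R]_d -> R) :
  measurable_fun setT u -> measurable_complex (fun x => expi (u x)).
Proof.
move=> mu; split => /=.
  by have := measurable_cosD 0 mu; under eq_fun do rewrite addr0.
have := measurable_cosD (- (pi / 2)) mu.
by under eq_fun do rewrite cosBpihalf.
Qed.

Lemma measurable_nsq f : measurable_complex f ->
  measurable_fun setT (fun x => nsq (f x)).
Proof. by move=> [m1 m2]; apply: measurable_funD; exact: measurable_funX. Qed.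

Lemma measurable_ensq f : measurable_complex f ->
  measurable_fun setT (fun x => (nsq (f x))%:E).
Proof. by move=> mf; apply/measurable_EFinP; exact: measurable_nsq. Qed.

Local Notation mu := (lebesgue_cV R d).

Definition L2sq f : \bar R := \int[mu]_x (nsq (f x))%:E.

Lemma L2sq_ge0 f : (0 <= L2sq f)%E.
Proof. by apply: integral_ge0 => x _; rewrite lee_fin nsq_ge0. Qed.

Lemma L2norm_sq f : L2norm f = (L2sq f `^ 2^-1)%E.
Proof.
rewrite /L2norm unlock; congr (_ `^ _)%E; apply: eq_integral => x _ /=.
congr (_%:E); rewrite /nsq; case: (f x) => a b /=.
by rewrite ger0_norm ?sqrtr_ge0// powR_mulrn ?sqrtr_ge0// sqr_sqrtr// addr_ge0 ?sqr_ge0.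
Qed.

Lemma L2norm_lt f (eps : R) : 0 < eps ->
  (L2sq f < (eps ^+ 2)%:E)%E -> (L2norm f < eps%:E)%E.
Proof.
move=> e0 fe; rewrite L2norm_sq.
have := L2sq_ge0 f; have : (L2sq f < +oo)%E by apply: lt_trans fe (ltry _).
case: (L2sq f) fe => // r; rewrite lte_fin lee_fin => re _ r0.
rewrite poweR_EFin lte_fin powR12_sqrt//.
by rewrite -(gtr0_norm e0) -sqrtr_sqr ltr_sqrt// exprn_gt0.
Qed.

Lemma L2P f : L2 f <-> measurable_complex f /\ (L2sq f < +oo)%E.
Proof.
split=> -[mf foo]; split=> //; move: foo; rewrite L2norm_sq.
  by apply: lty_poweRy; rewrite invr_eq0.
exact: poweR_lty.
Qed.

Lemma L2sqZ z f : measurable_complex f ->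
  L2sq (fun x => z * f x) = ((nsq z)%:E * L2sq f)%E.
Proof.
move=> mf; rewrite /L2sq -ge0_integralZl_EFin ?nsq_ge0//.
- by apply: eq_integral => x _; rewrite nsqM EFinM.
- by move=> x _; rewrite lee_fin nsq_ge0.
- exact: measurable_ensq.
Qed.

(** This quadratic bound stands in for the triangle inequality, and is the origin of eps / 4 in the
    closure lemmas below. *)
Lemma L2sqD_le f g : measurable_complex f -> measurable_complex g ->
  (L2sq (fun x => f x + g x)%R <= 2%:E * L2sq f + 2%:E * L2sq g)%E.
Proof.
move=> mf mg; rewrite /L2sq -!ge0_integralZl_EFin//; last 4 first.
- by move=> x _; rewrite lee_fin nsq_ge0.
- exact: measurable_ensq.
- by move=> x _; rewrite lee_fin nsq_ge0.
- exact: measurable_ensq.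
rewrite -ge0_integralD//; last 4 first.
- by move=> x _; rewrite -EFinM lee_fin mulr_ge0 ?nsq_ge0.
- by apply: measurable_funeM; exact: measurable_ensq.
- by move=> x _; rewrite -EFinM lee_fin mulr_ge0 ?nsq_ge0.
- by apply: measurable_funeM; exact: measurable_ensq.
apply: ge0_le_integral => //.
- by move=> x _; rewrite lee_fin nsq_ge0.
- by apply: measurable_ensq; exact: measurable_complexD.
- by apply: emeasurable_funD; apply: measurable_funeM; exact: measurable_ensq.
- by move=> x _; rewrite lee_fin nsqD_le.
Qed.

End complex_valued.

(** * Finite spans and their closure in L2 *)

Section L2_span.
Context {R : realType} {d : nat} {I : eqType}.
Variables (S : set I) (e : I -> 'cV[R]_d -> R[i]).
Hypothesis me : forall i, S i -> measurable_complex (e i).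
Local Open Scope complex_scope.
Implicit Types (f g : 'cV[R]_d -> R[i]).

(** A list of pairs may repeat an index, so adding combinations is concatenating lists. *)
Definition in_span f := exists t : seq (R[i] * I),
  (forall p, p \in t -> S p.2) /\ f = fun x => \sum_(p <- t) p.1 * e p.2 x.

Definition in_L2_closure f := measurable_complex f /\
  forall eps : R, 0 < eps ->
    exists g, in_span g /\ (L2sq (fun x => f x - g x)%R < eps%:E)%E.

Lemma in_span_measurable g : in_span g -> measurable_complex g.
Proof.
case=> t [tS ->]; elim: t tS => [|p t IHt] tS.
  under eq_fun do rewrite big_nil.
  exact: measurable_complex_cst.
under eq_fun do rewrite big_cons.
apply: measurable_complexD; last first.
  by apply: IHt => q qt; apply: tS; rewrite in_cons qt orbT.
apply: measurable_complexM; first exact: measurable_complex_cst.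
by apply: me; apply: tS; exact: mem_head.
Qed.

Lemma L2_closure0 : in_L2_closure (fun=> 0).
Proof.
split=> [|eps e0]; first exact: measurable_complex_cst.
exists (fun=> 0); split; last first.
  by rewrite /L2sq; under eq_integral do rewrite subrr nsq0; rewrite integral0.
by exists [::]; split=> //; apply/funext => x; rewrite big_nil.
Qed.

Lemma L2_closure_mem i : S i -> in_L2_closure (e i).
Proof.
move=> Si; split; first exact: me.
move=> eps e0; exists (e i); split.
  exists [:: (1, i)]; split; first by move=> p; rewrite inE => /eqP ->.
  by apply/funext => x; rewrite big_seq1 mul1r.
rewrite /L2sq; under eq_integral do rewrite subrr nsq0.
by rewrite integral0.
Qed.

Lemma L2_closure_scale c f : in_L2_closure f -> in_L2_closure (fun x => c * f x).
Proof.
move=> [mf fS]; split.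
  by apply: measurable_complexM => //; exact: measurable_complex_cst.
move=> eps e0.
(* Adding 1 makes the divisor positive even for c = 0. *)
have c1 : 0 < 1 + nsq c by rewrite ltr_pwDl ?nsq_ge0.
have [g [gS fg]] := fS (eps / (1 + nsq c)) (divr_gt0 e0 c1).
exists (fun x => c * g x); split.
  have [t [tS ->]] := gS; exists [seq (c * p.1, p.2) | p <- t]; split.
    by move=> p /mapP[q qt ->] /=; exact: tS.
  by apply/funext => x; rewrite big_map mulr_sumr; apply: eq_bigr => p _; rewrite mulrA.
under [X in L2sq X]eq_fun do rewrite -mulrBr.
rewrite L2sqZ; last exact: measurable_complexB (in_span_measurable gS).
apply: (@le_lt_trans _ _ ((1 + nsq c)%:E * L2sq (fun x => f x - g x)%R)%E).
  by apply: lee_wpmul2r; [exact: L2sq_ge0|rewrite lee_fin lerDr].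
by rewrite muleC -lte_pdivlMr.
Qed.

Lemma L2_closure_add f g : in_L2_closure f -> in_L2_closure g ->
  in_L2_closure (fun x => f x + g x).
Proof.
move=> [mf fS] [mg gS]; split; first exact: measurable_complexD.
move=> eps e0.
have e4 : 0 < eps / 4 by lra.
have [f' [fS' ff']] := fS _ e4.
have [g' [gS' gg']] := gS _ e4.
exists (fun x => f' x + g' x); split.
  have [[t [tS ->]] [s [sS ->]]] := (fS', gS').
  exists (t ++ s); split; first by move=> p; rewrite mem_cat => /orP[/tS|/sS].
  by apply/funext => x; rewrite big_cat.
under [X in L2sq X]eq_fun do rewrite opprD addrACA.
apply: (le_lt_trans (L2sqD_le _ _)).
- exact: measurable_complexB (in_span_measurable fS').
- exact: measurable_complexB (in_span_measurable gS').
rewrite (_ : eps%:E = 2%:E * (eps / 4)%:E + 2%:E * (eps / 4)%:E)%E.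
  by apply: lteD; rewrite lte_pmul2l.
by rewrite -!EFinM -EFinD; congr (_%:E); field.
Qed.

Lemma L2_closure_lim f : measurable_complex f ->
  (forall eps : R, 0 < eps ->
    exists g, in_L2_closure g /\ (L2sq (fun x => f x - g x)%R < eps%:E)%E) ->
  in_L2_closure f.
Proof.
move=> mf fS; split=> // eps e0.
have e4 : 0 < eps / 4 by lra.
have [g [[mg gS] fg]] := fS _ e4.
have [h [hS gh]] := gS _ e4.
exists h; split=> //.
rewrite (_ : (fun x => _) = fun x => (f x - g x) + (g x - h x)); last first.
  by apply/funext => x; rewrite addrA subrK.
apply: (le_lt_trans (L2sqD_le _ _)).
- exact: measurable_complexB.
- exact: measurable_complexB (in_span_measurable hS).
rewrite (_ : eps%:E = 2%:E * (eps / 4)%:E + 2%:E * (eps / 4)%:E)%E.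
  by apply: lteD; rewrite lte_pmul2l.
by rewrite -!EFinM -EFinD; congr (_%:E); field.
Qed.

Lemma L2_closure_approx f eps : in_L2_closure f -> 0 < eps ->
  exists (s : seq I) (c : I -> R[i]), (forall i, i \in s -> S i) /\
    (L2norm (fun x => f x - \sum_(i <- s) c i * e i x)%R < eps%:E)%E.
Proof.
move=> [_ fS] e0.
have [_ [[t [tS ->]] ft]] := fS _ (exprn_gt0 2 e0).
(* The basis definition attaches one coefficient to each index, so the coefficients of a repeated
   index are added up. *)
exists (undup (map snd t)), (fun i => \sum_(p <- t | p.2 == i) p.1); split.
  by move=> i; rewrite mem_undup => /mapP[p pt ->]; exact: tS.
apply: L2norm_lt => //; rewrite (_ : (fun x => _) =
  fun x => f x - \sum_(p <- t) p.1 * e p.2 x)//.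
apply/funext => x; congr (_ - _).
under eq_bigr do rewrite mulr_suml.
rewrite (exchange_big_dep predT)//= big_seq [RHS]big_seq; apply: eq_bigr => p pt.
under eq_bigl do rewrite eq_sym.
rewrite -big_filter (filter_pred1_uniq (x := p.2)) ?undup_uniq//.
  by rewrite big_seq1.
by rewrite mem_undup; apply/mapP; exists p.
Qed.

(** Dominated convergence, applied to |f - F n|^2, turns pointwise convergence into L2
    convergence. *)
Lemma L2_closure_dominated (F : nat -> 'cV[R]_d -> R[i]) f (G : 'cV[R]_d -> \bar R) :
  (forall n, in_L2_closure (F n)) -> measurable_complex f ->
  (lebesgue_cV R d).-integrable setT G ->
  (forall n x, ((nsq (f x - F n x))%:E <= G x)%E) ->
  (forall x, nsq (f x - F n x) @[n --> \oo] --> (0 : R)) ->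
  in_L2_closure f.
Proof.
move=> FS mf iG FG Ff; apply: L2_closure_lim => // eps e0.
have [] := @dominated_convergence _ _ _ (lebesgue_cV R d) setT measurableT
  (fun n x => (nsq (f x - F n x))%:E) (cst 0%E) G.
- move=> n; apply: measurable_ensq; apply: measurable_complexB => //.
  by case: (FS n).
- exact: measurable_cst.
- by apply: aeW => x _; apply: cvg_EFin; [exact: nearW|exact: Ff].
- by [].
- by apply: aeW => x n _; rewrite gee0_abs ?lee_fin ?nsq_ge0.
move=> _ _; rewrite integral0 => lim0.
have : \forall n \near \oo, (\int[lebesgue_cV R d]_x (nsq (f x - F n x))%:E < eps%:E)%E.
  exact: (lim0 _ (nbhs_open_ereal_lt (f := cst eps) e0)).
by case=> N _ /(_ N (leqnn N)) /= h; exists (F N).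
Qed.

End L2_span.

(** * The Gabor system *)

Section fibred_gabor_system.
Context {R : realType}.
Variables (d : nat) (P F : 'M[R]_d).
Hypothesis uP : P \in unitmx.
Local Open Scope complex_scope.

Local Notation mu := (lebesgue_cV R d).

Let vol : R := fine (mu (cell P 0)).
Let c : R := (Num.sqrt vol)^-1.

Let vol_gt0 : 0 < vol.
Proof.
by rewrite fine_gt0// (lebesgue_cell_gt0 uP 0) (lebesgue_cell_lty uP 0).
Qed.

Let volE k : mu (cell P k) = vol%:E.
Proof.
rewrite (lebesgue_cell uP) fineK// ge0_fin_numE ?measure_ge0//.
exact: lebesgue_cell_lty.
Qed.

Let c_neq0 : c != 0.
Proof. by rewrite invr_eq0 gt_eqF// sqrtr_gt0. Qed.

Let c2_vol : c ^+ 2 * vol = 1.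
Proof. by rewrite exprVn sqr_sqrtr ?ltW// mulVf// gt_eqF. Qed.

Definition fibred_point (k l : 'cV[int]_d) : 'cV[R]_(d + d) :=
  col_mx (P *m int_cV R k) (F *m int_cV R k + dual_point P l).

Lemma int_cV_inj n : injective (@int_cV R n).
Proof.
move=> k l /matrixP kl; apply/matrixP => i j.
by have := kl i j; rewrite !mxE => /intr_inj.
Qed.

Lemma fibred_point_inj k l k' l' :
  fibred_point k l = fibred_point k' l' -> k = k' /\ l = l'.
Proof.
move=> /eq_col_mx[kk ll].
have ek : k = k' by apply: (@int_cV_inj d); rewrite -(mulKmx uP (int_cV R k)) kk mulKmx.
move: ll; rewrite ek => /addrI ll; split=> //.
have uPT : (invmx P)^T \in unitmx by rewrite unitmx_tr unitmx_inv.
by apply: (@int_cV_inj d); rewrite -(mulKmx uPT (int_cV R l)) [_ *m int_cV R l]ll mulKmx.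
Qed.

Let e (z : 'cV[R]_(d + d)) := tf_shift z (normalized_indicator (cell P 0)).

Let freq k l (x : 'cV[R]_d) : R :=
  2 * pi * dotprod (F *m int_cV R k + dual_point P l) x.

Lemma tf_shift_fibred k l x : e (fibred_point k l) x =
  expi (freq k l x) * (c * \1_(cell P k) x)%:C.
Proof.
rewrite /e /tf_shift /fibred_point col_mxKu col_mxKd; congr (_ * _).
rewrite /normalized_indicator -/vol -/c; congr ((_ * _)%:C).
rewrite !indicE; congr (_%:R); congr nat_of_bool.
rewrite -(cell_shift uP 0 k) add0r; apply/idP/idP; rewrite !inE /= subrK//.
Qed.

Let measurable_freq k l : measurable_fun setT (freq k l).
Proof. by apply: measurable_funM => //; exact: measurable_dotprod. Qed.

Let measurable_indic_cell k : measurable_fun setT (\1_(cell P k) : _ -> R).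
Proof. by apply: measurable_indic; exact: measurable_cell. Qed.

Lemma measurable_tf_shift_fibred k l : measurable_complex (e (fibred_point k l)).
Proof.
rewrite (funext (tf_shift_fibred k l)).
apply: measurable_complexM; first exact: measurable_complex_expi.
by apply: measurable_complex_real; exact: measurable_funM.
Qed.

Lemma integrable_indic_cell k (r : R) :
  mu.-integrable setT (fun x => (r * \1_(cell P k) x)%:E).
Proof.
under eq_fun do rewrite EFinM.
apply: integrableZl => //; apply/integrableP; split; first exact/measurable_EFinP.
under eq_integral do rewrite gee0_abs ?lee_fin//.
rewrite integral_indic ?setIT//; first exact: lebesgue_cell_lty.
exact: measurable_cell.
Qed.

Lemma L2_tf_shift_fibred k l : L2 (e (fibred_point k l)).
Proof.
apply/L2P; split; first exact: measurable_tf_shift_fibred.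
have -> : L2sq (e (fibred_point k l)) = (\int[mu]_x `|(c ^+ 2 * \1_(cell P k) x)%:E|)%E.
  apply: eq_integral => x _; rewrite tf_shift_fibred nsqM nsq_expi mul1r nsq_real.
  rewrite gee0_abs; last by rewrite lee_fin (mulr_ge0 (sqr_ge0 _))// indicE.
  by rewrite exprMn indicE; case: (_ \in _); rewrite ?expr1n ?expr0n.
by have /integrableP[_ h] := integrable_indic_cell k (c ^+ 2); exact: h.
Qed.

(** Taken at a = 0 and a = - pi / 2, this yields the real and the imaginary part of an inner product
    at once. *)
Lemma Rintegral_indic_cell_trig_char k l a :
  \int[mu]_x (c ^+ 2 * \1_(cell P k) x * trig_char P l a x) = (l == 0)%:R * cos a.
Proof.
transitivity (c ^+ 2 * \int[mu]_(x in cell P k) trig_char P l a x).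
  rewrite -RintegralZl//; first last.
  - apply: (integrable_bounded_cell uP (k := k) (M := 1)) => //.
    + exact: measurable_cell.
    + exact: measurable_trig_char.
    + exact: trig_char_bounded.
  - exact: measurable_cell.
  rewrite [RHS]Rintegral_mkcond; apply: eq_Rintegral => x _.
  rewrite patchE indicE; case: (_ \in _); rewrite ?mulr1// mulr0 mul0r//.
have [->|l0] := eqVneq l 0; last by rewrite Rintegral_cell_trig_char// mulr0 mul0r.
rewrite (_ : trig_char P 0 a = fun=> cos a); last first.
  apply/funext => x; rewrite /trig_char dual_point0 dotprodE trmx0 mul0mx mxE.
  by rewrite mulr0 add0r.
rewrite Rintegral_cst; last exact: measurable_cell.
rewrite [fine _](_ : _ = vol); last exact: (congr1 fine (volE k)).
by rewrite mulrCA c2_vol mulr1 mul1r.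
Qed.

Lemma orthonormal_fibred k l k' l' :
  L2inner (e (fibred_point k l)) (e (fibred_point k' l')) =
  (fibred_point k l == fibred_point k' l')%:R.
Proof.
have prodE x : e (fibred_point k l) x * (e (fibred_point k' l') x)^* =
    expi (freq k l x - freq k' l' x) *
      (c ^+ 2 * (\1_(cell P k) x * \1_(cell P k') x))%:C.
  rewrite !tf_shift_fibred; apply/eqP.
  rewrite eq_complex /expi /= !cosB !sinB; apply/andP; split; apply/eqP; ring.
rewrite /L2inner (funext prodE) /complex_integral.
have [kk|kk] := eqVneq k k'; last first.
  have ind0 x : \1_(cell P k) x * \1_(cell P k') x = 0 :> R.
    rewrite !indicE; case: (boolP (x \in cell P k)) => [|_]; last by rewrite mul0r.
    rewrite inE => xk; rewrite memNset ?mulr0// => xk'.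
    by move/eqP: kk; apply; rewrite -xk -xk'.
  under eq_Rintegral do rewrite ind0 mulr0 mulr0 /=.
  under [X in _ +i* X]eq_Rintegral do rewrite ind0 mulr0 mulr0 /=.
  rewrite Rintegral_cst// mul0r (_ : _ == _ = false)//.
  by apply/negbTE/eqP => /fibred_point_inj[/eqP]; rewrite (negbTE kk).
subst k'.
(* The frequency F k common to the tile cancels, leaving the character of index l - l'. *)
have freqB x : freq k l x - freq k l' x = 2 * pi * dotprod (dual_point P (l - l')) x.
  by rewrite /freq dual_pointD dual_pointN !dotprodDl dotprodNl; ring.
have ReE x : complex.Re (expi (freq k l x - freq k l' x) *
    (c ^+ 2 * (\1_(cell P k) x * \1_(cell P k) x))%:C) =
    c ^+ 2 * \1_(cell P k) x * trig_char P (l - l') 0 x.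
  rewrite Re_mulc /= mulr0 subr0 freqB /trig_char addr0 mulrC; congr (_ * _ * _).
  by rewrite indicE; case: (_ \in _); rewrite ?mulr1 ?mulr0.
have ImE x : complex.Im (expi (freq k l x - freq k l' x) *
    (c ^+ 2 * (\1_(cell P k) x * \1_(cell P k) x))%:C) =
    c ^+ 2 * \1_(cell P k) x * trig_char P (l - l') (- (pi / 2)) x.
  rewrite Im_mulc /= mulr0 add0r freqB /trig_char cosBpihalf mulrC; congr (_ * _ * _).
  by rewrite indicE; case: (_ \in _); rewrite ?mulr1 ?mulr0.
under eq_Rintegral do rewrite ReE.
under [X in _ +i* X]eq_Rintegral do rewrite ImE.
rewrite !Rintegral_indic_cell_trig_char cos0 cosN cos_pihalf mulr0 mulr1 subr_eq0.
have -> : (fibred_point k l == fibred_point k l') = (l == l').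
  by apply/eqP/eqP => [/fibred_point_inj[]|->].
by case: (_ == _).
Qed.

Let S : set 'cV[R]_(d + d) := [set fibred_point kl.1 kl.2 | kl in setT].

Let me z : S z -> measurable_complex (e z).
Proof. by move=> [[k l] _ <-]; exact: measurable_tf_shift_fibred. Qed.

Local Notation W := (in_L2_closure S e).

(** The unimodular factor shared by all the elements living on tile k, cut off to that tile. *)
Let wave k (x : 'cV[R]_d) : R[i] :=
  expi (2 * pi * dotprod (F *m int_cV R k) x) * (\1_(cell P k) x)%:C.

Let measurable_wave k : measurable_complex (wave k).
Proof.
apply: measurable_complexM; last exact: measurable_complex_real.
by apply/measurable_complex_expi/measurable_funM => //; exact: measurable_dotprod.
Qed.

Lemma closure_wave_expi k l :
  W (fun x => wave k x * expi (2 * pi * dotprod (dual_point P l) x)).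
Proof.
rewrite (_ : (fun x => _) = fun x => c^-1%:C * e (fibred_point k l) x).
  by apply/(L2_closure_scale me)/(L2_closure_mem me); exists (k, l).
apply/funext => x; rewrite tf_shift_fibred.
have -> : freq k l x = 2 * pi * dotprod (F *m int_cV R k) x +
    2 * pi * dotprod (dual_point P l) x by rewrite /freq dotprodDl mulrDr.
rewrite expiD /wave.
rewrite (_ : (\1_(cell P k) x)%:C = c^-1%:C * (c * \1_(cell P k) x)%:C); last first.
  by rewrite -rmorphM mulKf.
by rewrite mulrAC mulrCA.
Qed.

Lemma closure_wave_trig_char k l a : W (fun x => wave k x * (trig_char P l a x)%:C).
Proof.
(* Euler's formula: the phase [a] is absorbed into the complex coefficients of the characters l and
   - l. *)
rewrite (_ : (fun x => _) = fun x =>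
   ((1 / 2)%:C * expi a) * (wave k x * expi (2 * pi * dotprod (dual_point P l) x)) +
   ((1 / 2)%:C * expi (- a)) *
     (wave k x * expi (2 * pi * dotprod (dual_point P (- l)) x))).
  by apply: (L2_closure_add me); apply: (L2_closure_scale me); exact: closure_wave_expi.
have cosE (t : R) : (cos t)%:C = (1 / 2)%:C * (expi t + expi (- t)).
  rewrite /expi cosN sinN; apply/eqP; rewrite eq_complex /=.
  by apply/andP; split; apply/eqP; field.
apply/funext => x; rewrite dual_pointN dotprodNl mulrN /trig_char cosE opprD !expiD.
ring.
Qed.

Lemma closure_wave_trig_closure k u :
  trig_closure P (cell P k) u -> W (fun x => wave k x * (u x)%:C).
Proof.
elim=> [l a|{}u v _ IHu _ IHv|r {}u _ IHu|U {}u M TU IHU mu UM Uu].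
- exact: closure_wave_trig_char.
- rewrite (_ : (fun x => _) = fun x => wave k x * (u x)%:C + wave k x * (v x)%:C).
    exact: (L2_closure_add me).
  by apply/funext => x; rewrite rmorphD mulrDr.
- rewrite (_ : (fun x => _) = fun x => r%:C * (wave k x * (u x)%:C)).
    exact: (L2_closure_scale me).
  by apply/funext => x; rewrite rmorphM mulrCA.
have [N uN] := trig_closure_bounded (Trig_lim TU mu UM Uu).
have nsqE n x : nsq (wave k x * (u x)%:C - wave k x * (U n x)%:C) =
    (u x - U n x) ^+ 2 * \1_(cell P k) x.
  rewrite -mulrBr -rmorphB nsqM /wave nsqM nsq_expi !nsq_real mul1r mulrC.
  by congr (_ * _); rewrite indicE; case: (_ \in _); rewrite ?expr1n ?expr0n.
(* On the tile |u| <= N and |U n| <= M, and off it [wave] vanishes; the bound is integrable since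
   the tile has finite measure. *)
apply: (L2_closure_dominated me IHU
    (G := fun x => ((N + M) ^+ 2 * \1_(cell P k) x)%:E)).
- by apply: measurable_complexM => //; exact: measurable_complex_real.
- exact: integrable_indic_cell.
- move=> n x; rewrite nsqE lee_fin indicE; case: (boolP (x \in cell P k)) => [|_].
    rewrite inE !mulr1 => xk.
    by have := uN x xk; have := UM n x xk; rewrite !ler_norml; nra.
  by rewrite !mulr0.
- move=> x; under eq_fun do rewrite nsqE.
  rewrite indicE; case: (boolP (x \in cell P k)) => [|_].
    rewrite inE => xk; under eq_fun do rewrite mulr1 expr2.
    have d0 : u x - U n x @[n --> \oo] --> (0 : R).
      by rewrite -(subrr (u x)); apply: cvgB; [exact: cvg_cst|exact: Uu].
    by rewrite -(mulr0 0); exact: cvgM.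
  by under eq_fun do rewrite mulr0; exact: cvg_cst.
Qed.

Lemma closure_wave_bounded k (h : 'cV[R]_d -> R[i]) (M : R) :
  measurable_complex h -> (forall x, nsq (h x) <= M) -> W (fun x => wave k x * h x).
Proof.
move=> [mh1 mh2] hM.
(* The inequality |a| <= 1 + a^2 gives a bound without square roots. *)
have bound (a b : R) : a ^+ 2 + b ^+ 2 <= M -> `|a| <= 1 + M /\ `|b| <= 1 + M.
  by rewrite !ler_norml => abM; split; nra.
have dense (u : 'cV[R]_d -> R) : measurable_fun setT u -> (forall x, `|u x| <= 1 + M) ->
    W (fun x => wave k x * (u x)%:C).
  by move=> mu uM; apply/closure_wave_trig_closure/trig_closure_dense.
rewrite (_ : (fun x => _) = fun x => wave k x * (complex.Re (h x))%:C +
    'i * (wave k x * (complex.Im (h x))%:C)).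
  apply: (L2_closure_add me); first by apply: dense => // x; have [] := bound _ _ (hM x).
  by apply: (L2_closure_scale me); apply: dense => // x; have [] := bound _ _ (hM x).
apply/funext => x; rewrite mulrCA -mulrDr; congr (_ * _).
by rewrite [LHS]complexE.
Qed.

(** The inverse of the unimodular factor in [wave] is put into the bounded function, whose modulus
    it preserves. *)
Lemma closure_cell_bounded k (h : 'cV[R]_d -> R[i]) (M : R) :
  measurable_complex h -> (forall x, nsq (h x) <= M) ->
  W (fun x => (\1_(cell P k) x)%:C * h x).
Proof.
move=> mh hM.
pose t x := 2 * pi * dotprod (F *m int_cV R k) x.
rewrite (_ : (fun x => _) = fun x => wave k x * (expi (- t x) * h x)).
  apply: (@closure_wave_bounded k _ M) => [|x]; last by rewrite nsqM nsq_expi mul1r.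
  apply: measurable_complexM => //; apply: measurable_complex_expi.
  rewrite /t; under eq_fun do rewrite -mulrN -dotprodNl.
  by apply: measurable_funM => //; exact: measurable_dotprod.
by apply/funext => x; rewrite /wave mulrACA -expiD subrr expi0 mul1r.
Qed.

(** [f] is cut off to the set where |f|^2 <= n and to finitely many tiles. The squared error is at
    each point either 0 or |f|^2, so |f|^2 dominates it, and it is eventually 0. *)
Lemma closure_L2 f : L2 f -> W f.
Proof.
case/L2P => mf foo.
have mnf := measurable_nsq mf.
pose kap (x : 'cV[R]_d) : 'cV[int]_d := floor_cV (invmx P *m x).
(* The tiles with code below n, without repetition so that each point is counted at most once in
   [fn]. *)
pose s n : seq 'cV[int]_d := undup (pmap unpickle (iota 0 n)).
pose trunc n : set 'cV[R]_d := [set x | nsq (f x) <= n%:R].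
have mtrunc n : measurable (trunc n).
  rewrite (_ : trunc n = (fun x => nsq (f x)) @^-1` `]-oo, n%:R]%classic).
    by rewrite -[X in measurable X]setTI; exact: mnf.
  by apply/seteqP; split=> x /=; rewrite in_itv.
pose h n x := (\1_(trunc n) x)%:C * f x.
have mh n : measurable_complex (h n).
  by apply: measurable_complexM => //; apply: measurable_complex_real; exact: measurable_indic.
have hn n x : nsq (h n x) <= n%:R.
  rewrite /h nsqM nsq_real indicE; case: (boolP (x \in _)) => [|_].
    by rewrite inE expr1n mul1r.
  by rewrite expr0n mul0r.
pose fn n x := \sum_(k <- s n) (\1_(cell P k) x)%:C * h n x.
have fnS n : W (fn n).
  rewrite /fn; elim: (s n) => [|k r IHr].
    under eq_fun do rewrite big_nil; exact: L2_closure0.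
  under eq_fun do rewrite big_cons.
  by apply: (L2_closure_add me) => //; exact: closure_cell_bounded (mh n) (hn n).
have fnE n x : fn n x = ((x \in trunc n) && (kap x \in s n))%:R * f x.
  rewrite /fn -mulr_suml /h mulrA; congr (_ * _).
  rewrite (_ : \sum_(k <- s n) _ = (kap x \in s n)%:R).
    by rewrite indicE mulrC; case: (_ \in _); case: (_ \in _); rewrite /= ?mulr1 ?mulr0.
  have : uniq (s n) by exact: undup_uniq.
  elim: (s n) => [|k r IHr] /=; first by rewrite big_nil.
  move=> /andP[kr /IHr IH]; rewrite big_cons IH in_cons indicE.
  have -> : (x \in cell P k) = (kap x == k).
    by apply/idP/eqP; rewrite inE.
  case: eqVneq => [->|_] /=; last by rewrite add0r.
  by rewrite (negbTE kr) addr0.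
have nsqB n x : nsq (f x - fn n x) = (~~ ((x \in trunc n) && (kap x \in s n)))%:R * nsq (f x).
  rewrite fnE; case: (_ && _); first by rewrite mul1r subrr nsq0 mul0r.
  by rewrite mul0r subr0 mul1r.
apply: (L2_closure_dominated me fnS mf (G := fun x => (nsq (f x))%:E)).
- apply/integrableP; split; first exact: measurable_ensq.
  by under eq_integral do rewrite gee0_abs ?lee_fin ?nsq_ge0//.
- move=> n x; rewrite nsqB lee_fin; case: (_ && _); rewrite /= ?mul1r ?mul0r ?nsq_ge0//.
- move=> x; apply: cvg_near_cst.
  near=> n; rewrite nsqB (_ : _ && _ = true) ?mul0r//; apply/andP; split.
    rewrite inE /trunc /=; near: n; exact: nbhs_infty_ger.
  rewrite mem_undup mem_pmap; apply/mapP; exists (pickle (kap x)); last by rewrite pickleK.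
  rewrite mem_iota add0n /=; near: n; exact: nbhs_infty_gt.
Unshelve. all: by end_near. Qed.

End fibred_gabor_system.

Theorem proposition5p4 (R : realType) (d : nat) (A B D : 'M[R]_d)
    (symAD : (invmx A *m D)^T = invmx A *m D)
    (ratAD : rational_mx (invmx A *m D))
    (AB : A^T *m B = 1%:M)
    (dens1 : lattice_density (block_mx A D 0 B) = 1) :
  exists K : set 'cV[R]_d,
    [/\ measurable K, (0 < lebesgue_cV R d K < +oo)%E
      & gabor_orthonormal_basis (normalized_indicator K)
          (lattice (block_mx A D 0 B))].
Proof.
have [P [F [uP ->]]] := lattice_fibration symAD ratAD AB.
exists (cell P 0); split; first exact: measurable_cell.
  by rewrite lebesgue_cell_gt0//=; exact: lebesgue_cell_lty.
split=> [_ [[k l] _ <-]|_ _ [[k l] _ <-] [[k' l'] _ <-]|f fL2 eps e0].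
- exact: L2_tf_shift_fibred.
- exact: orthonormal_fibred.
- exact: L2_closure_approx (closure_L2 F uP fL2) e0.
Qed.
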